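(* Let $x \in \mathbb{C}\setminus(\mathbb{R}^-\cup\{1\})$ and let $\nu\in\mathbb{C}$ with $\mathrm{Re}(\nu)<0$. Let $E^*,K\in\mathscr{H}_0$ have power series expansions $$E^*(z)=\sum_{\ell\geq1}E_\ell\,\frac{z^\ell}{\ell!},\qquad K(z)=\sum_{b\geq1}(-1)^bK_b\,\frac{z^b}{b!},\qquad z\in\mathbb{C}.$$ Then the equation $\mathfrak{L}E^*(z)=K(z)$, $z\in\mathbb{C}$ (with $\mathfrak{L}$ defined in the context) is equivalent to the infinite lower-triangular linear system $$\sum_{\ell=1}^b(-1)^\ell\binom{b}{\ell}\,Q_{b,\ell}\,E_\ell=K_b,\qquad b\geq 1,$$ with coefficients $$Q_{b,\ell}=-\frac{\Gamma(b)\Gamma(1-b\nu)}{\Gamma(b-b\nu)}\,\frac{x^{1-b}}{1-x}\,F(\ell-b,-b\nu;-b;x),\qquad 1\leq\ell\leq b.$$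
   Context: $\mathbb{R}^-=\,]-\infty,0]$. $\mathscr{H}_0$ is the linear space of entire functions on $\mathbb{C}$ vanishing at $0$. With $\mathfrak{R}(\zeta) = (1-\zeta)^{-\nu}(1-(1-x)\zeta)^{\nu-1}$ for $\zeta\in[0,1]$ (principal branches) and $c=\frac{1-\nu x}{1-x}$, the operator $\mathfrak{L}:\mathscr{H}_0\to\mathscr{H}_0$ is $$\mathfrak{L}f(z)=\int_0^1\Big[(1+z\,\mathfrak{R}(\zeta))\,f(\zeta\,\mathfrak{R}(\zeta)\,z)-c\,z\,\mathfrak{R}(\zeta)\,f'(\zeta\,\mathfrak{R}(\zeta)\,z)\Big]e^{-\mathfrak{R}(\zeta)z}\,\mathrm{d}\zeta,\qquad z\in\mathbb{C},\ f\in\mathscr{H}_0.$$ The hypergeometric polynomial is $F(\ell-b,-b\nu;-b;x)=\sum_{m=0}^{b-\ell}\frac{(\ell-b)_m(-b\nu)_m}{(-b)_m\,m!}x^m$, where $(a)_m=a(a+1)\cdots(a+m-1)$, $(a)_0=1$. *)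

(* Defs.v *)
From Stdlib Require Import Reals Lra Factorial.
From Coquelicot Require Import Coquelicot.

Set Implicit Arguments.
Open Scope R_scope.
Open Scope C_scope.

Definition Cexp (z : C) : C := exp (Re z) * (cos (Im z), sin (Im z)).

(* Principal argument, in ]-PI, PI]; it is 2 atan (Im z / (|z| + Re z)) off the
   closed negative half-line, on which |z| + Re z = 0.  The value at 0 is
   irrelevant. *)
Definition Carg (z : C) : R :=
  if Rlt_dec 0 (Cmod z + Re z)
  then (2 * atan (Im z / (Cmod z + Re z)))%R
  else PI.

Definition Clog (z : C) : C := (ln (Cmod z), Carg z).

Lemma Carg_bound (z : C) : (- PI < Carg z <= PI)%R.
Proof.
unfold Carg; destruct (Rlt_dec _ _) as [_|_].
- generalize (atan_bound (Im z / (Cmod z + Re z))); lra.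
- generalize PI_RGT_0; lra.
Qed.

Lemma Cexp_Clog (z : C) : z <> 0 -> Cexp (Clog z) = z.
Proof.
intros Hz.
assert (Hm : (0 < Cmod z)%R) by now apply Cmod_gt_0.
assert (Hs : (Cmod z * Cmod z = Re z * Re z + Im z * Im z)%R).
{ generalize (Cmod2_alt z); intros H; simpl in H; lra. }
unfold Cexp, Clog; simpl; rewrite exp_ln by assumption.
assert (H : (Cmod z * cos (Carg z) = Re z /\ Cmod z * sin (Carg z) = Im z)%R).
{ unfold Carg; destruct (Rlt_dec _ _) as [Hp|Hp].
  - set (d := (Cmod z + Re z)%R) in *; set (t := (Im z / d)%R).
    assert (Ht : (1 + t * t <> 0)%R) by nra.
    assert (Hc : (0 < cos (atan t))%R)
      by (apply cos_gt_0; generalize (atan_bound t); lra).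
    assert (Hsn : (sin (atan t) = t * cos (atan t))%R).
    { rewrite <- (tan_atan t) at 2; unfold tan; field; lra. }
    assert (Hcc : (cos (atan t) * cos (atan t) * (1 + t * t) = 1)%R).
    { generalize (sin2_cos2 (atan t)); unfold Rsqr; rewrite Hsn; lra. }
    assert (Hq : (cos (atan t) * cos (atan t) = / (1 + t * t))%R).
    { apply Rmult_eq_reg_r with (1 + t * t)%R; [|exact Ht].
      rewrite Hcc; field; exact Ht. }
    assert (Hi : (1 + t * t = 2 * Cmod z / d)%R).
    { unfold t; apply Rmult_eq_reg_r with (d * d)%R; [|nra].
      field_simplify; [|lra|lra]; unfold d; nra. }
    assert (Hdz : (d <> 0)%R) by lra.
    assert (Hq' : (cos (atan t) * cos (atan t) = d / (2 * Cmod z))%R).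
    { rewrite Hq, Hi; field; lra. }
    rewrite cos_2a_cos, sin_2a, Hsn; split.
    + replace (2 * cos (atan t) * cos (atan t))%R
        with (2 * (cos (atan t) * cos (atan t)))%R by ring.
      rewrite Hq'; unfold d; field; lra.
    + replace (2 * (t * cos (atan t)) * cos (atan t))%R
        with (2 * t * (cos (atan t) * cos (atan t)))%R by ring.
      rewrite Hq'; unfold t; field; lra.
  - generalize (re_le_Cmod z); unfold Rabs; rewrite cos_PI, sin_PI.
    destruct (Rcase_abs _); intros Hr; split; nra. }
destruct z as [a b]; simpl in *; destruct H as [Ha Hb].
unfold Cmult; simpl; rewrite !Rmult_0_l, Rminus_0_r, Rplus_0_r.
now rewrite Ha, Hb.
Qed.

(* Principal branch of z^w, with 0^w = 0 for w <> 0. *)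
Definition Cpower (z w : C) : C :=
  if Ceq_dec z 0 then (if Ceq_dec w 0 then 1 else 0) else Cexp (w * Clog z).

(* Euler's integral over ]0, +oo[; meaningful for Re s > 0, which covers all the
   arguments used below. *)
Definition CGamma (s : C) : C :=
  RInt_gen (V := C_R_CompleteNormedModule)
    (fun t : R => Cpower t (s - 1) * exp (- t))
    (at_right 0%R) (Rbar_locally p_infty).

Fixpoint poch (a : C) (m : nat) : C :=
  match m with
  | O => 1
  | S m' => poch a m' * (a + INR m')
  end.

(* F(-n, beta; gamma; x), truncated at the degree n; the truncation matters when
   gamma is itself a negative integer (here gamma = -b with n < b). *)
Definition hypergeom_poly (n : nat) (beta gamma x : C) : C :=
  sum_n (G := C_AbelianMonoid)
    (fun m => poch (- INR n) m * poch beta m / (poch gamma m * INR (fact m))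
              * x ^ m) n.

Definition entire (f : C -> C) : Prop :=
  forall z : C, ex_derive (K := C_AbsRing) (V := C_NormedModule) f z.

Definition H0 (f : C -> C) : Prop := entire f /\ f 0 = 0.

Section Operator.

Variables x nu : C.

Definition Rfun (zeta : R) : C :=
  Cpower (1 - zeta) (- nu) * Cpower (1 - (1 - x) * zeta) (nu - 1).

Definition cst : C := (1 - nu * x) / (1 - x).

Definition Lop (f : C -> C) (z : C) : C :=
  RInt (V := C_R_CompleteNormedModule)
    (fun zeta : R =>
       ((1 + z * Rfun zeta) * f (zeta * Rfun zeta * z)
        - cst * z * Rfun zeta * C_derive f (zeta * Rfun zeta * z))
       * Cexp (- (Rfun zeta * z)))
    0%R 1%R.

(* For b >= 1, x^(1-b) is written / x^(b-1). *)
Definition Qcoef (b l : nat) : C :=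
  - (CGamma (INR b) * CGamma (1 - INR b * nu) / CGamma (INR b - INR b * nu))
  * (/ x ^ (b - 1) / (1 - x))
  * hypergeom_poly (b - l) (- (INR b * nu)) (- INR b) x.

End Operator.

(* Main.v *)
Require Import Defs.
From Stdlib Require Import Reals Factorial Lra Lia.
From Coquelicot Require Import Coquelicot.

(* Write [a = 1 - x], [q = 1 - a zeta] and [n = b - l].  Expanding the integrand
   of [Lop] in powers of [z] (a Cauchy product with the series of [exp (- R z)],
   uniformly convergent in [zeta] because [R] is bounded) gives
     [Lop E z = sum_b (-1)^b z^b / b! * sum_l (-1)^l C(b,l) M(b,l) E_l]
   with the moments
     [M(b,l) = int_0^1 R^b ((1 - n) zeta^l - c l zeta^(l-1)) d zeta],
   so by uniqueness of Taylor coefficients the theorem amounts to [M = Q].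

   Let [u = - nu] and [t = (1 - zeta) / q], a Mobius map under which
   [1 - t = x zeta / q].  Then [R = t^u / q] and the integrand of [M(b,l)] is, up
   to the derivative of [- t^(bu) zeta^l q^(1-b) / a] (which vanishes at both
   ends), [(u / a) t^(bu-1) t' q^(1-b) zeta^(l-1) (l + n zeta)].  The mean of the
   binomial law,
     [l + n zeta = sum_m (l + n - m) C(n,m) zeta^(n-m) (1 - zeta)^m],
   rewrites the last polynomial in terms of [t] and [1 - t], so that every term is
   a complete Beta integral; the [x^m] are the ones of the hypergeometric
   polynomial. *)

Set Implicit Arguments.
Open Scope R_scope.
Open Scope C_scope.

(** Two obstacles shape the proof. First, t runs along a curve in C, and the pieces produced by the
    integration by parts behave like (1 - zeta)^(bu - 1), unbounded at 1 when Re(bu) < 1. So nothing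
    is ever substituted: [newton] certifies an integral by an antiderivative with limits at the
    ends, the Beta integrals are computed with the antiderivatives t^s (1 - t)^k, and Riemann
    integration enters only after the pieces are recombined into an integrand that is continuous on
    [0, 1]. Second, [Qcoef] divides by a value of Gamma. The Beta integrals come out as k! /
    (s)_(k+1), so only the functional equation links them to Gamma; but replacing Gamma(1 - b nu) /
    Gamma(b - b nu) by 1 / (1 - b nu)_(b-1) requires Gamma(1 - b nu) to be nonzero. This is proved
    from Euler's integral, for all Re s >= 1, in [CGamma_neq_0]. The factor 1 - n of the moments
    comes from (1 + w) e^(-w) = sum_n (1 - n) (-w)^n / n!, taken at w = R z. *)

Local Notation is_derC f t l :=
  (is_derive (K := R_AbsRing) (V := C_R_NormedModule) f t (l%C : C)).
Local Notation limC f F l := (filterlim f F (locally (T := C_UniformSpace) (l%C : C))).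
Local Notation contC f t :=
  (continuous (T := R_UniformSpace) (U := C_UniformSpace) f t).
Local Notation Csum := (sum_n (G := C_AbelianMonoid)).
Local Notation is_Cseries a l := (is_series (K := C_AbsRing) (V := C_NormedModule) a (l%C : C)).

(** * Calculus for functions from [R] to [C] *)

(** Structure operations unfold in several layers, hence the repetition; the [refine] restates the
    goal as an equality in [R], the form that [ring] recognizes. *)
Ltac Rring := do 3 (unfold Re, Im, minus, plus, opp, scal, mult, zero, one; simpl);
  match goal with |- @eq _ ?a ?b => refine (_ : @eq R a b) end; ring.

Lemma C_eq (a b : C) : Re a = Re b -> Im a = Im b -> a = b.
Proof. destruct a, b; simpl; congruence. Qed.

(** Reduces complex-valued curves to real calculus: the product rule and the derivatives of [Cexp]
    and [Clog] are then computed on components. The converse rebuilds [f] from the vectors 1 and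
    [Ci]. *)
Lemma is_derC_iff (f : R -> C) t l :
  is_derC f t l <->
  is_derive (fun t => Re (f t)) t (Re l) /\ is_derive (fun t => Im (f t)) t (Im l).
Proof.
split.
- intros H; split.
  + exact (filterdiff_comp' f (fst : C_R_NormedModule -> R_NormedModule) t _ _ H
             (filterdiff_linear _ is_linear_fst)).
  + exact (filterdiff_comp' f (snd : C_R_NormedModule -> R_NormedModule) t _ _ H
             (filterdiff_linear _ is_linear_snd)).
- intros [H1 H2].
  apply is_derive_ext with
    (fun t => plus (scal (Re (f t)) (RtoC 1 : C_R_NormedModule)) (scal (Im (f t)) (Ci : C_R_NormedModule))).
  { intros s; destruct (f s); apply C_eq; Rring. }
  replace l with (plus (scal (Re l) (RtoC 1 : C_R_NormedModule)) (scal (Im l) (Ci : C_R_NormedModule))).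
  2:{ destruct l; apply C_eq; Rring. }
  exact (is_derive_plus (K := R_AbsRing) (V := C_R_NormedModule) _ _ t _ _
    (is_derive_scal_l (V := C_R_NormedModule) _ t _ (RtoC 1) H1)
    (is_derive_scal_l (V := C_R_NormedModule) _ t _ Ci H2)).
Qed.

Lemma limC_iff {T} (F : (T -> Prop) -> Prop) {FF : Filter F} (f : T -> C) l :
  limC f F l <->
  filterlim (fun t => Re (f t)) F (locally (Re l)) /\
  filterlim (fun t => Im (f t)) F (locally (Im l)).
Proof.
rewrite !filterlim_locally; split.
- intros H; split; intros e; generalize (H e); apply filter_imp; intros y [H1 H2]; assumption.
- intros [H1 H2] e; generalize (filter_and _ _ (H1 e) (H2 e)); apply filter_imp; intros y [H3 H4]; split; assumption.
Qed.

Lemma is_derC_mult (f g : R -> C) t lf lg :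
  is_derC f t lf -> is_derC g t lg ->
  is_derC (fun t => f t * g t) t (lf * g t + f t * lg).
Proof.
rewrite !is_derC_iff; intros [H1 H2] [H3 H4]; split.
- evar_last.
  apply (is_derive_minus (fun t => Re (f t) * Re (g t))%R (fun t => Im (f t) * Im (g t))%R);
    apply (is_derive_mult (K := R_AbsRing)); try eassumption; intros; apply Rmult_comm.
  Rring.
- evar_last.
  apply (is_derive_plus (fun t => Re (f t) * Im (g t))%R (fun t => Im (f t) * Re (g t))%R);
    apply (is_derive_mult (K := R_AbsRing)); try eassumption; intros; apply Rmult_comm.
  Rring.
Qed.

Lemma is_derC_plus (f g : R -> C) t lf lg :
  is_derC f t lf -> is_derC g t lg -> is_derC (fun t => f t + g t) t (lf + lg).
Proof. exact (is_derive_plus (K := R_AbsRing) (V := C_R_NormedModule) f g t lf lg). Qed.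

Lemma is_derC_const (c : C) t : is_derC (fun _ => c) t 0.
Proof. exact (is_derive_const (K := R_AbsRing) (V := C_R_NormedModule) c t). Qed.

Lemma is_derC_scal (c : C) (f : R -> C) t lf :
  is_derC f t lf -> is_derC (fun t => c * f t) t (c * lf).
Proof.
intros H; evar_last; [exact (is_derC_mult (is_derC_const c t) H)|].
apply C_eq; Rring.
Qed.

Lemma is_derC_RtoC (f : R -> R) t l :
  is_derive f t l -> is_derC (fun t => RtoC (f t)) t (RtoC l).
Proof.
intros H; apply is_derC_iff; split; [exact H|].
exact (is_derive_const (K := R_AbsRing) (V := R_NormedModule) 0%R t).
Qed.

Lemma is_derC_pow (f : R -> C) t l n :
  is_derC f t l -> is_derC (fun t => f t ^ n) t (INR n * l * f t ^ (n - 1)).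
Proof.
intros H; induction n as [|n IH].
- evar_last; [exact (is_derC_const 1 t)|simpl; ring].
- evar_last; [exact (is_derC_mult H IH)|].
  rewrite S_INR, RtoC_plus; destruct n as [|n].
  + simpl; ring.
  + replace (S (S n) - 1)%nat with (S n) by lia.
    replace (S n - 1)%nat with n by lia; rewrite (Cpow_S _ n); ring.
Qed.

Lemma is_derC_contC (f : R -> C) t l : is_derC f t l -> contC f t.
Proof.
intros H; apply (ex_derive_continuous (K := R_AbsRing) (V := C_R_NormedModule)).
now exists l.
Qed.

Lemma limC_mult {T} (F : (T -> Prop) -> Prop) {FF : Filter F} (f g : T -> C) lf lg :
  limC f F lf -> limC g F lg -> limC (fun t => f t * g t) F (lf * lg).
Proof.
rewrite !limC_iff by assumption; intros [H1 H2] [H3 H4].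
assert (M : forall (u v : T -> R) lu lv, filterlim u F (locally lu) ->
  filterlim v F (locally lv) -> filterlim (fun t => u t * v t)%R F (locally (lu * lv)%R)).
{ intros u v lu lv Hu Hv.
  eapply filterlim_comp_2; [exact Hu|exact Hv|].
  exact (filterlim_mult (K := R_AbsRing) lu lv). }
assert (P : forall (u v : T -> R) lu lv, filterlim u F (locally lu) ->
  filterlim v F (locally lv) -> filterlim (fun t => u t + v t)%R F (locally (lu + lv)%R)).
{ intros u v lu lv Hu Hv.
  eapply filterlim_comp_2; [exact Hu|exact Hv|].
  exact (filterlim_plus (V := R_NormedModule) lu lv). }
assert (N : forall (u : T -> R) lu, filterlim u F (locally lu) ->
  filterlim (fun t => - u t)%R F (locally (- lu)%R)).
{ intros u lu Hu.
  eapply filterlim_comp; [exact Hu|exact (filterlim_opp (V := R_NormedModule) lu)]. }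
split.
- exact (P _ _ _ _ (M _ _ _ _ H1 H3) (N _ _ (M _ _ _ _ H2 H4))).
- exact (P _ _ _ _ (M _ _ _ _ H1 H4) (M _ _ _ _ H2 H3)).
Qed.

Lemma limC_plus {T} (F : (T -> Prop) -> Prop) {FF : Filter F} (f g : T -> C) lf lg :
  limC f F lf -> limC g F lg -> limC (fun t => f t + g t) F (lf + lg).
Proof.
intros Hf Hg; eapply filterlim_comp_2; [exact Hf|exact Hg|].
exact (filterlim_plus (V := C_R_NormedModule) lf lg).
Qed.

Lemma limC_const {T} (F : (T -> Prop) -> Prop) {FF : Filter F} (c : C) :
  limC (fun _ : T => c) F c.
Proof. apply filterlim_const. Qed.

Lemma limC_pow {T} (F : (T -> Prop) -> Prop) {FF : Filter F} n (f : T -> C) l :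
  limC f F l -> limC (fun t => f t ^ n) F (l ^ n).
Proof.
intros H; induction n as [|n IH]; [exact (@limC_const T F FF 1)|].
exact (@limC_mult T F FF _ _ _ _ H IH).
Qed.

Ltac solve_limC :=
  repeat first [assumption | typeclasses eauto | apply limC_const | apply limC_mult | apply limC_plus].

Lemma limC_norm0 {T} (F : (T -> Prop) -> Prop) {FF : Filter F} (f : T -> C) (g : T -> R) :
  F (fun t => (Cmod (f t) <= g t)%R) -> filterlim g F (locally 0%R) -> limC f F 0.
Proof.
intros H Hg; apply filterlim_locally; intros e.
generalize (filter_and _ _ H (proj1 (filterlim_locally g 0%R) Hg e)).
apply filter_imp; intros t [H1 H2].
assert (H3 : (Cmod (f t) < e)%R).
{ eapply Rle_lt_trans; [exact H1|].
  revert H2; unfold ball; simpl; unfold AbsRing_ball, abs, minus, plus, opp; simpl.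
  rewrite Ropp_0, Rplus_0_r; apply Rle_lt_trans, Rle_abs. }
split; unfold ball; simpl; unfold AbsRing_ball, abs, minus, plus, opp; simpl;
  rewrite Ropp_0, Rplus_0_r; eapply Rle_lt_trans; try exact H3.
- eapply Rle_trans; [apply Rmax_l|apply Rmax_Cmod].
- eapply Rle_trans; [apply Rmax_r|apply Rmax_Cmod].
Qed.

(** * Complex exponential and principal logarithm along real curves *)

Lemma Cexp_plus (a b : C) : Cexp (a + b) = Cexp a * Cexp b.
Proof.
unfold Cexp; simpl; rewrite exp_plus, cos_plus, sin_plus; apply C_eq; Rring.
Qed.

Lemma Cexp_0 : Cexp 0 = 1.
Proof. unfold Cexp; simpl; rewrite exp_0, cos_0, sin_0; apply C_eq; Rring. Qed.

Lemma Cmod_Cexp (z : C) : Cmod (Cexp z) = exp (Re z).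
Proof.
unfold Cexp; rewrite Cmod_mult, Cmod_R, Rabs_pos_eq by (left; apply exp_pos).
unfold Cmod; simpl; rewrite !Rmult_1_r.
generalize (sin2_cos2 (Im z)); unfold Rsqr; intros H.
rewrite Rplus_comm in H; unfold Im in *; rewrite H, sqrt_1; ring.
Qed.

Lemma Cexp_neq_0 z : Cexp z <> 0.
Proof.
intros H; generalize (Cmod_Cexp z); rewrite H, Cmod_0.
generalize (exp_pos (Re z)); lra.
Qed.

Lemma Cexp_opp z : Cexp (- z) = / Cexp z.
Proof.
assert (H : Cexp (- z) * Cexp z = 1).
{ rewrite <- Cexp_plus, Cplus_comm, Cplus_opp_r; apply Cexp_0. }
replace (Cexp (- z)) with (Cexp (- z) * Cexp z * / Cexp z).
- rewrite H; ring.
- field; apply Cexp_neq_0.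
Qed.

Lemma Cexp_RtoC (x : R) : Cexp x = exp x.
Proof. unfold Cexp; simpl; rewrite cos_0, sin_0; apply C_eq; Rring. Qed.

Lemma Cexp_INR_mult n z : Cexp (INR n * z) = Cexp z ^ n.
Proof.
induction n as [|n IH].
- simpl; rewrite Cmult_0_l; apply Cexp_0.
- rewrite S_INR, RtoC_plus, Cmult_plus_distr_r, Cexp_plus, IH, Cmult_1_l, Cpow_S; ring.
Qed.

Lemma is_derC_Cexp (g : R -> C) t l :
  is_derC g t l -> is_derC (fun t => Cexp (g t)) t (l * Cexp (g t)).
Proof.
rewrite !is_derC_iff; intros [H1 H2].
assert (He := is_derive_comp exp _ t _ _ (is_derive_exp (Re (g t))) H1).
assert (Hc := is_derive_comp cos _ t _ _ (is_derive_cos (Im (g t))) H2).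
assert (Hs := is_derive_comp sin _ t _ _ (is_derive_sin (Im (g t))) H2).
split.
- apply is_derive_ext with (fun t => exp (Re (g t)) * cos (Im (g t)))%R.
  { intros s; unfold Cexp; simpl; Rring. }
  evar_last.
  + apply (is_derive_mult (K := R_AbsRing)); [exact He|exact Hc|intros; apply Rmult_comm].
  + Rring.
- apply is_derive_ext with (fun t => exp (Re (g t)) * sin (Im (g t)))%R.
  { intros s; unfold Cexp; simpl; Rring. }
  evar_last.
  + apply (is_derive_mult (K := R_AbsRing)); [exact He|exact Hs|intros; apply Rmult_comm].
  + Rring.
Qed.

Lemma is_derive_eq (f : R -> R) t l l' : is_derive f t l -> l = l' -> is_derive f t l'.
Proof. now intros H <-. Qed.

Lemma is_derC_eq (f : R -> C) t l l' : is_derC f t l -> l = l' -> is_derC f t l'.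
Proof. now intros H <-. Qed.

(* The open slit plane C \ ]-oo, 0], on which the principal logarithm is smooth. *)
Definition slit (z : C) : Prop := (0 < Cmod z + Re z)%R.

Lemma slit_iff z : slit z <-> ~ (Im z = 0%R /\ (Re z <= 0)%R).
Proof.
unfold slit; assert (H := Cmod2_alt z); assert (H1 := Cmod_ge_0 z).
assert (H2 := re_le_Cmod z); apply Rabs_le_between in H2.
split.
- intros H3 [H4 H5]; simpl in H; rewrite H4 in H.
  assert (Cmod z = - Re z)%R by nra; lra.
- intros H3; destruct (Rlt_dec 0 (Cmod z + Re z)) as [h|h]; [exact h|].
  exfalso; apply H3; assert (H4 : (Cmod z = - Re z)%R) by lra.
  simpl in H; rewrite H4 in H; split; [nra|lra].
Qed.

Lemma slit_neq_0 z : slit z -> z <> 0.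
Proof. intros H Hz; rewrite Hz in H; unfold slit in H; rewrite Cmod_0 in H; simpl in H; lra. Qed.

(** With g = p + iq and m = |g|, the components are ln m and 2 atan (q / (m + p)); the derivative
    follows from m' = (p p' + q q') / m, and m^2 = p^2 + q^2 eliminates q. *)
Lemma is_derC_Clog (g : R -> C) t l :
  is_derC g t l -> slit (g t) -> is_derC (fun t => Clog (g t)) t (l / g t).
Proof.
intros H Hs; assert (Hn := slit_neq_0 Hs).
destruct (proj1 (is_derC_iff _ _ _) H) as [H1 H2].
set (p := Re (g t)); set (q := Im (g t)); set (m := Cmod (g t)).
assert (Hm : (0 < m)%R) by now apply Cmod_gt_0.
assert (Hm2 : (m * m = p * p + q * q)%R).
{ generalize (Cmod2_alt (g t)); fold m p q; simpl; lra. }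
unfold slit in Hs; fold m p in Hs.
assert (Hmod : is_derive (fun t => Cmod (g t)) t ((p * Re l + q * Im l) / m)%R).
{ apply is_derive_ext with (fun t => sqrt (Re (g t) * Re (g t) + Im (g t) * Im (g t)))%R.
  { intros s; unfold Cmod, Re, Im; f_equal; simpl; ring. }
  assert (Hq : sqrt (Re (g t) * Re (g t) + Im (g t) * Im (g t)) = m).
  { unfold m, Cmod, Re, Im; f_equal; simpl; ring. }
  assert (Hd : is_derive (fun t => Re (g t) * Re (g t) + Im (g t) * Im (g t))%R t
    (2 * (p * Re l + q * Im l))%R).
  { eapply is_derive_eq.
    - apply (is_derive_plus (V := R_NormedModule));
      apply (is_derive_mult (K := R_AbsRing)); try eassumption; intros; apply Rmult_comm.
    - unfold p, q; Rring. }
  eapply is_derive_eq.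
  - apply is_derive_sqrt; [exact Hd|fold p q; rewrite <- Hm2; nra].
  - simpl; rewrite Hq; field; lra. }
apply is_derC_iff; split.
- eapply is_derive_eq.
  + unfold Clog; simpl.
    exact (is_derive_comp ln (fun t => Cmod (g t)) t _ _ (is_derive_ln _ Hm) Hmod).
  + unfold Cdiv, Cinv; simpl; fold p q m; unfold scal; simpl; unfold mult; simpl.
    change (fst (g t)) with p; change (snd (g t)) with q.
    replace (p * (p * 1) + q * (q * 1))%R with (m * m)%R by (rewrite Hm2; ring).
    unfold Re, Im; field; lra.
- assert (Hsum : is_derive (fun t => Cmod (g t) + Re (g t))%R t ((p * Re l + q * Im l) / m + Re l)%R).
  { exact (is_derive_plus (V := R_NormedModule) _ _ t _ _ Hmod H1). }
  apply is_derive_ext_loc with (fun t => 2 * atan (Im (g t) / (Cmod (g t) + Re (g t))))%R.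
  (* The test in [Carg] stays positive near [t] by continuity, so locally only the arctangent branch
     is seen. *)
  { assert (Hc : continuous (fun t => Cmod (g t) + Re (g t))%R t).
    { apply (ex_derive_continuous (K := R_AbsRing) (V := R_NormedModule)); eexists; exact Hsum. }
    generalize (Hc _ (open_gt 0%R _ Hs)); unfold filtermap; apply filter_imp.
    intros s Hs'; unfold Clog, Carg; simpl.
    destruct (Rlt_dec _ _) as [_|h]; [reflexivity|contradiction]. }
  eapply is_derive_eq.
  + apply is_derive_scal.
    refine (is_derive_comp atan (fun t => Im (g t) / (Cmod (g t) + Re (g t)))%R t _ _ (is_derive_atan _) _).
    apply is_derive_div; [exact H2|exact Hsum|fold m p; lra].
  + unfold Cdiv, Cinv; simpl; fold p q m; unfold scal; simpl; unfold mult; simpl.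
    change (fst (g t)) with p; change (snd (g t)) with q.
    replace (p * (p * 1) + q * (q * 1))%R with (m * m)%R by (rewrite Hm2; ring).
    unfold Rsqr; change (fst l) with (Re l); change (snd l) with (Im l).
    set (d := (m + p)%R) in *.
    (* Half-angle identity: d = m + p gives d^2 + q^2 = 2 m d. *)
    replace (1 + q / d * (q / d))%R with (2 * m / d)%R.
    2:{ apply Rmult_eq_reg_r with (d * d)%R; [|nra]. field_simplify; [|lra|lra].
        unfold d; nra. }
    field_simplify; [|lra|lra].
    apply Rmult_eq_reg_r with (d * m ^ 3)%R; [|apply Rmult_integral_contrapositive; split; [lra|apply pow_nonzero; lra]].
    field_simplify; [|lra|lra].
    unfold d; replace (q ^ 2)%R with (m * m - p * p)%R by (rewrite Hm2; ring).
    ring.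
Qed.

(** * Newton integrals *)

(* Integration by exhibiting an antiderivative on the open domain together with
   its limits at the two ends: no integrability of [f] is required, so that
   integration by parts may produce singular integrands. *)
Definition newton (D : R -> Prop) (Fa Fb : (R -> Prop) -> Prop) (f : R -> C) (v : C) : Prop :=
  exists (H : R -> C) (la lb : C),
    (forall t, D t -> is_derC H t (f t)) /\ limC H Fa la /\ limC H Fb lb /\ v = lb - la.

Lemma newton_ext D Fa Fb f g v :
  (forall t, D t -> f t = g t) -> newton D Fa Fb f v -> newton D Fa Fb g v.
Proof.
intros E (H & la & lb & H1 & H2); exists H, la, lb; split; [|exact H2].
intros t Ht; rewrite <- (E t Ht); auto.
Qed.

Lemma newton_val D Fa Fb f v v' : newton D Fa Fb f v -> v = v' -> newton D Fa Fb f v'.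
Proof. now intros H <-. Qed.

Lemma newton_plus D Fa Fb {FFa : Filter Fa} {FFb : Filter Fb} f g v w :
  newton D Fa Fb f v -> newton D Fa Fb g w ->
  newton D Fa Fb (fun t => f t + g t) (v + w).
Proof.
intros (H & la & lb & H1 & H2 & H3 & ->) (G & ma & mb & G1 & G2 & G3 & ->).
exists (fun t => H t + G t), (la + ma), (lb + mb); split; [|split; [|split]].
- intros t Ht; apply is_derC_plus; auto.
- solve_limC.
- solve_limC.
- ring.
Qed.

Lemma newton_scal D Fa Fb {FFa : Filter Fa} {FFb : Filter Fb} c f v :
  newton D Fa Fb f v -> newton D Fa Fb (fun t => c * f t) (c * v).
Proof.
intros (H & la & lb & H1 & H2 & H3 & ->).
exists (fun t => c * H t), (c * la), (c * lb); split; [|split; [|split]].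
- intros t Ht; apply is_derC_scal; auto.
- solve_limC.
- solve_limC.
- ring.
Qed.

Lemma newton_sum_n D Fa Fb {FFa : Filter Fa} {FFb : Filter Fb}
  (f : nat -> R -> C) (v : nat -> C) n :
  (forall k, (k <= n)%nat -> newton D Fa Fb (f k) (v k)) ->
  newton D Fa Fb (fun t => sum_n (G := C_AbelianMonoid) (fun k => f k t) n)
    (sum_n (G := C_AbelianMonoid) v n).
Proof.
induction n as [|n IH]; intros H.
- rewrite sum_O; eapply newton_ext; [|apply (H 0%nat); lia].
  intros t _; now rewrite sum_O.
- rewrite sum_Sn; eapply newton_ext.
  + intros t _; symmetry; apply sum_Sn.
  + apply newton_plus; [assumption|assumption|apply IH; intros; apply H; lia|apply H; lia].
Qed.

(** A continuous [f] also has its Riemann primitive [G], which is continuous up to the ends. [G] and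
    the given antiderivative [H] differ by a constant inside the interval, so the limits of [H]
    yield the increment of [G]. Continuity is asked on the whole line, so integrands are extended
    beyond [0, 1] before this is applied. *)
Lemma newton_RInt (f : R -> C) v a b :
  newton (fun t => a < t < b)%R (at_right a) (at_left b) f v -> (a < b)%R ->
  (forall t, contC f t) ->
  is_RInt (V := C_R_CompleteNormedModule) f a b v.
Proof.
intros (H & la & lb & H1 & H2 & H3 & ->) Hab Hc.
set (G := fun y => RInt (V := C_R_CompleteNormedModule) f a y).
assert (HI : forall y z, is_RInt (V := C_R_CompleteNormedModule) f y z (G z - G y)).
{ intros y z.
  assert (E : forall c d, is_RInt (V := C_R_CompleteNormedModule) f c d
            (RInt (V := C_R_CompleteNormedModule) f c d)).
  { intros c d; apply (RInt_correct (V := C_R_CompleteNormedModule)).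
    apply (ex_RInt_continuous (V := C_R_CompleteNormedModule)); intros; apply Hc. }
  replace (G z - G y) with (plus (opp (G y : C_R_CompleteNormedModule)) (G z))
    by (unfold plus, opp; simpl; unfold Cminus; apply Cplus_comm).
  apply (is_RInt_Chasles (V := C_R_CompleteNormedModule)) with a.
  - apply (is_RInt_swap (V := C_R_CompleteNormedModule)), E.
  - apply E. }
assert (Gc : forall z, limC G (locally z) (G z)).
{ intros z; apply (is_derC_contC (f := G) (l := f z)).
  apply (is_derive_RInt (V := C_R_NormedModule) f G a z).
  - exists (mkposreal 1 Rlt_0_1); intros y _.
    evar_last; [exact (HI a y)|].
    unfold G; rewrite (RInt_point (V := C_R_CompleteNormedModule)).
    apply C_eq; Rring.
  - apply Hc. }
assert (K : forall c d, (a < c < b)%R -> (a < d < b)%R -> G d - H d = G c - H c).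
{ intros c d Hc' Hd.
  assert (E : is_RInt (V := C_R_CompleteNormedModule) f c d (H d - H c)).
  { apply (is_RInt_derive (V := C_R_CompleteNormedModule)).
    - intros t Ht; apply H1; revert Ht; unfold Rmin, Rmax.
      destruct (Rle_dec c d); lra.
    - intros; apply Hc. }
  generalize (is_RInt_unique (V := C_R_CompleteNormedModule) _ _ _ _ E).
  rewrite (is_RInt_unique (V := C_R_CompleteNormedModule) _ _ _ _ (HI c d)).
  intros E'. replace (G d) with (G d - G c + G c) by ring; rewrite E'; ring. }
assert (Hmid : (a < (a + b) / 2 < b)%R) by lra.
set (m := ((a + b) / 2)%R) in *.
assert (Ka : G a - la = G m - H m).
{ apply (filterlim_locally_unique (V := C_R_NormedModule) (F := at_right a) (fun t => G t - H t)).
  - apply limC_plus; [typeclasses eauto| |].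
    + eapply filterlim_filter_le_1; [|apply Gc].
      intros P HP; unfold at_right, within; revert HP; apply filter_imp; auto.
    + replace (- la) with (-(1) * la) by ring.
      apply filterlim_ext with (fun t => -(1) * H t); [intros; ring|].
      solve_limC.
  - apply filterlim_ext_loc with (fun _ : R => G m - H m).
    + exists (mkposreal (b - a) (proj2 (Rlt_0_minus _ _) Hab)).
      intros t Ht Hat; symmetry; apply K; [lra|split; [lra|]].
      revert Ht; unfold ball; simpl; unfold AbsRing_ball, abs, minus, plus, opp; simpl.
      intros Ht; apply Rabs_lt_between in Ht; lra.
    + apply filterlim_const. }
assert (Kb : G b - lb = G m - H m).
{ apply (filterlim_locally_unique (V := C_R_NormedModule) (F := at_left b) (fun t => G t - H t)).
  - apply limC_plus; [typeclasses eauto| |].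
    + eapply filterlim_filter_le_1; [|apply Gc].
      intros P HP; unfold at_left, within; revert HP; apply filter_imp; auto.
    + replace (- lb) with (-(1) * lb) by ring.
      apply filterlim_ext with (fun t => -(1) * H t); [intros; ring|].
      solve_limC.
  - apply filterlim_ext_loc with (fun _ : R => G m - H m).
    + exists (mkposreal (b - a) (proj2 (Rlt_0_minus _ _) Hab)).
      intros t Ht Hat; symmetry; apply K; [lra|split; [|lra]].
      revert Ht; unfold ball; simpl; unfold AbsRing_ball, abs, minus, plus, opp; simpl.
      intros Ht; apply Rabs_lt_between in Ht; lra.
    + apply filterlim_const. }
evar_last; [exact (HI a b)|].
replace (G b) with (G b - lb + lb) by ring; rewrite Kb, <- Ka; simpl; ring.
Qed.

Local Notation newton0 :=
  (newton (fun t => 0 < t)%R (at_right 0%R) (Rbar_locally p_infty)).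

Local Notation newton1 :=
  (newton (fun t => 0 < t < 1)%R (at_right 0%R) (at_left 1%R)).

Lemma newton_RInt_gen (f : R -> C) v :
  newton0 f v -> (forall t, (0 < t)%R -> contC f t) ->
  is_RInt_gen (V := C_R_NormedModule) f (at_right 0%R) (Rbar_locally p_infty) v.
Proof.
intros (H & la & lb & H1 & H2 & H3 & ->) Hc P HP.
assert (L : limC (fun ab => H (snd ab) + -(1) * H (fst ab))
  (filter_prod (at_right 0%R) (Rbar_locally p_infty)) (lb + -(1) * la)).
{ apply limC_plus; [typeclasses eauto| |].
  - eapply filterlim_comp; [apply filterlim_snd|exact H3].
  - apply limC_mult; [typeclasses eauto|solve_limC|].
    eapply filterlim_comp; [apply filterlim_fst|exact H2]. }
assert (L' : filter_prod (at_right 0%R) (Rbar_locally p_infty)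
  (fun ab => 0 < fst ab /\ 0 < snd ab)%R).
{ exists (fun t => 0 < t)%R (fun t => 0 < t)%R.
  - exists (mkposreal 1 Rlt_0_1); auto.
  - now exists 0%R.
  - auto. }
replace (lb - la) with (lb + -(1) * la) in HP by ring.
assert (LP := L P HP); unfold filtermap in LP.
unfold filtermapi; generalize (filter_and _ _ L' LP); apply filter_imp.
intros [a b] [[Ha Hb] HPab]; simpl in *.
exists (H b + -(1) * H a); split; [|exact HPab].
replace (H b + -(1) * H a) with (minus (H b : C_R_CompleteNormedModule) (H a))
  by (apply C_eq; Rring).
assert (Hmin : (0 < Rmin a b)%R) by (unfold Rmin; destruct (Rle_dec a b); lra).
apply (is_RInt_derive (V := C_R_CompleteNormedModule)).
- intros t Ht; apply H1; lra.
- intros t Ht; apply Hc; lra.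
Qed.

(** The real part of the antiderivative is strictly increasing, but limits keep only weak
    inequalities; strictness is saved by comparing the two limits with the values at the interior
    points 1 and 2. *)
Lemma newton_Re_pos (f : R -> C) v :
  newton0 f v -> (forall t, (0 < t)%R -> (0 < Re (f t))%R) -> (0 < Re v)%R.
Proof.
intros (H & la & lb & H1 & H2 & H3 & ->) Hf.
assert (I : forall s t, (0 < s)%R -> (s < t)%R -> (Re (H s) < Re (H t))%R).
{ intros s t Hs Hst; apply (incr_function (fun t => Re (H t)) 0%R p_infty (fun t => Re (f t))); simpl; auto; [|intros r Hr _; apply Hf, Hr].
  intros r Hr _; apply (proj1 (is_derC_iff _ _ _) (H1 r Hr)). }
apply limC_iff in H2; [|apply within_filter, locally_filter].
apply limC_iff in H3; [|apply Rbar_locally_filter].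
assert (A : Rbar_le (Re la) (Re (H 1%R))).
{ apply (filterlim_le (F := at_right 0%R) (fun t => Re (H t)) (fun _ => Re (H 1%R))).
  - exists (mkposreal 1 Rlt_0_1); intros t Ht H0t.
    revert Ht; unfold ball; simpl; unfold AbsRing_ball, abs, minus, plus, opp; simpl.
    intros Ht; apply Rabs_lt_between in Ht; left; apply I; lra.
  - apply H2.
  - apply filterlim_const. }
assert (B : Rbar_le (Re (H 2%R)) (Re lb)).
{ apply (filterlim_le (F := Rbar_locally p_infty) (fun _ => Re (H 2%R)) (fun t => Re (H t))).
  - exists 2%R; intros t Ht; left; apply I; lra.
  - apply filterlim_const.
  - apply H3. }
simpl in A, B; assert (E := I 1%R 2%R ltac:(lra) ltac:(lra)).
unfold Re in *; simpl; lra.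
Qed.

Lemma norm_C_R (z : C) : norm (z : C_R_NormedModule) = Cmod z.
Proof.
change (sqrt (Rabs (fst z) ^ 2 + Rabs (snd z) ^ 2) = Cmod z)%R.
now rewrite !pow2_abs.
Qed.

(** Dominated convergence with an explicit primitive [G] of the majorant: increments of the integral
    [H] of [f] are bounded by those of [G], so the Cauchy criterion at both ends passes from [G] to
    [H]. *)
Lemma newton_dominated (f : R -> C) (g G : R -> R) (la lb : R) :
  (forall t, (0 < t)%R -> contC f t) ->
  (forall t, (0 < t)%R -> continuous g t) ->
  (forall t, (0 < t)%R -> (Cmod (f t) <= g t)%R) ->
  (forall t, (0 < t)%R -> is_derive G t (g t)) ->
  filterlim G (at_right 0%R) (locally la) ->
  filterlim G (Rbar_locally p_infty) (locally lb) ->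
  exists v, newton0 f v.
Proof.
intros Hc Hgc Hfg HG Ha Hb.
set (H := fun y => RInt (V := C_R_CompleteNormedModule) f 1%R y).
assert (E : forall c d, (0 < c)%R -> (0 < d)%R -> is_RInt (V := C_R_CompleteNormedModule) f c d
            (RInt (V := C_R_CompleteNormedModule) f c d)).
{ intros c d Hc0 Hd; apply (RInt_correct (V := C_R_CompleteNormedModule)).
  apply (ex_RInt_continuous (V := C_R_CompleteNormedModule)); intros t Ht; apply Hc.
  revert Ht; unfold Rmin; destruct (Rle_dec c d); lra. }
assert (HI : forall y z, (0 < y)%R -> (0 < z)%R ->
  is_RInt (V := C_R_CompleteNormedModule) f y z (H z - H y)).
{ intros y z Hy Hz.
  replace (H z - H y) with (plus (opp (H y : C_R_CompleteNormedModule)) (H z))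
    by (unfold plus, opp; simpl; unfold Cminus; apply Cplus_comm).
  apply (is_RInt_Chasles (V := C_R_CompleteNormedModule)) with 1%R.
  - apply (is_RInt_swap (V := C_R_CompleteNormedModule)), E; lra.
  - apply E; lra. }
assert (HD : forall z, (0 < z)%R -> is_derC H z (f z)).
{ intros z Hz; apply (is_derive_RInt (V := C_R_NormedModule) f H 1%R z).
  - exists (mkposreal z Hz); intros y Hy.
    apply E; [lra|].
    revert Hy; unfold ball; simpl; unfold AbsRing_ball, abs, minus, plus, opp; simpl.
    intros Hy; apply Rabs_lt_between in Hy; lra.
  - now apply Hc. }
assert (B1 : forall y z, (0 < y)%R -> (y <= z)%R -> (Cmod (H z - H y) <= G z - G y)%R).
{ intros y z Hy Hyz.
  rewrite <- norm_C_R; apply (norm_RInt_le (V := C_R_NormedModule) f g y z).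
  - exact Hyz.
  - intros t Ht; rewrite norm_C_R; apply Hfg; lra.
  - apply HI; lra.
  - apply (is_RInt_derive (V := R_CompleteNormedModule)); intros t Ht;
      rewrite Rmin_left in Ht by lra; [apply HG|apply Hgc]; lra. }
assert (B : forall y z, (0 < y)%R -> (0 < z)%R -> (Cmod (H z - H y) <= Rabs (G z - G y))%R).
{ intros y z Hy Hz; destruct (Rle_dec y z) as [h|h].
  - eapply Rle_trans; [apply B1; assumption|apply Rle_abs].
  - rewrite Rabs_minus_sym; replace (H z - H y) with (- (H y - H z)) by ring.
    rewrite Cmod_opp; eapply Rle_trans; [apply B1; lra|apply Rle_abs]. }
assert (L : forall (F : (R -> Prop) -> Prop) l, ProperFilter F -> F (fun t => 0 < t)%R ->
  filterlim G F (locally l) -> exists m : C, limC H F m).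
{ intros F l PF F0 HF.
  apply (filterlim_locally_cauchy (U := C_R_CompleteNormedModule) H).
  intros e.
  destruct (proj2 (filterlim_locally_cauchy (F := F) (U := R_CompleteNormedModule) G)
    (ex_intro _ l HF) e) as [P [HP1 HP2]].
  exists (fun t => P t /\ (0 < t)%R); split; [now apply filter_and|].
  intros u v [Hu Hu0] [Hv Hv0]; generalize (HP2 u v Hu Hv) (B u v Hu0 Hv0).
  unfold ball; simpl; unfold prod_ball, ball; simpl.
  unfold AbsRing_ball, abs, minus, plus, opp; simpl.
  generalize (Rmax_Cmod (H v - H u)); intros K1 K2 K3; split.
  - generalize (Rmax_l (Rabs (fst (H v - H u)%C)) (Rabs (snd (H v - H u)%C))).
    unfold Cminus, Cplus, Copp in *; simpl in *; unfold Rminus in *; lra.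
  - generalize (Rmax_r (Rabs (fst (H v - H u)%C)) (Rabs (snd (H v - H u)%C))).
    unfold Cminus, Cplus, Copp in *; simpl in *; unfold Rminus in *; lra. }
destruct (L (at_right 0%R) la) as [ma Hma]; [apply at_right_proper_filter| |exact Ha|].
{ exists (mkposreal 1 Rlt_0_1); auto. }
destruct (L (Rbar_locally p_infty) lb) as [mb Hmb]; [apply Rbar_locally_filter| |exact Hb|].
{ now exists 0%R. }
exists (mb - ma), H, ma, mb; split; [exact HD|auto].
Qed.

(** * The Gamma function *)

Definition gamma_integrand (s : C) (t : R) : C := Cpower t (s - 1) * exp (- t).

Definition is_gamma (s v : C) : Prop := newton0 (gamma_integrand s) v.

Lemma Clog_pos (t : R) : (0 < t)%R -> Clog t = ln t.
Proof.
intros Ht; unfold Clog, Carg; rewrite Cmod_R, Rabs_pos_eq by lra; simpl.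
destruct (Rlt_dec _ _) as [_|h]; [|lra].
unfold Rdiv; rewrite Rmult_0_l, atan_0, Rmult_0_r; reflexivity.
Qed.

Lemma Cpower_pos (t : R) (w : C) : (0 < t)%R -> Cpower t w = Cexp (w * ln t).
Proof.
intros Ht; unfold Cpower; destruct (Ceq_dec t 0) as [h|h].
- apply RtoC_inj in h; lra.
- now rewrite Clog_pos.
Qed.

Lemma gamma_integrand_pos s t : (0 < t)%R ->
  gamma_integrand s t = Cexp ((s - 1) * ln t - t).
Proof.
intros Ht; unfold gamma_integrand; rewrite Cpower_pos by assumption.
unfold Cminus at 2; rewrite Cexp_plus, <- Cexp_RtoC, RtoC_opp; reflexivity.
Qed.

Lemma gamma_integrand_succ s t : (0 < t)%R ->
  gamma_integrand (s + 1) t = t * gamma_integrand s t.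
Proof.
intros Ht; rewrite !gamma_integrand_pos by assumption.
replace ((s + 1 - 1) * ln t - t) with (ln t + ((s - 1) * ln t - t)) by ring.
rewrite Cexp_plus, Cexp_RtoC, exp_ln by assumption; reflexivity.
Qed.

Lemma is_derC_gamma_integrand s t : (0 < t)%R ->
  is_derC (gamma_integrand s) t (((s - 1) / t - 1) * gamma_integrand s t).
Proof.
intros Ht.
apply is_derive_ext_loc with (fun t : R => Cexp ((s - 1) * ln t + -(1) * t)).
{ exists (mkposreal t Ht); intros y Hy; rewrite gamma_integrand_pos.
  - f_equal; ring.
  - revert Hy; unfold ball; simpl; unfold AbsRing_ball, abs, minus, plus, opp; simpl.
    intros Hy; apply Rabs_lt_between in Hy; lra. }
eapply is_derC_eq.
- apply is_derC_Cexp, is_derC_plus; apply is_derC_scal, is_derC_RtoC.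
  + apply is_derive_ln, Ht.
  + exact (is_derive_id (K := R_AbsRing) t).
- rewrite gamma_integrand_pos by assumption.
  replace ((s - 1) * ln t + -(1) * t) with ((s - 1) * ln t - t) by ring.
  rewrite RtoC_inv by lra; unfold one; simpl; unfold Cdiv.
  match goal with |- @eq _ ?a ?b => change (@eq C a b) end; ring.
Qed.

Lemma gamma_integrand_contC s t : (0 < t)%R -> contC (gamma_integrand s) t.
Proof. intros Ht; exact (is_derC_contC (is_derC_gamma_integrand s Ht)). Qed.

Lemma Cmod_gamma_integrand s t : (0 < t)%R ->
  Cmod (gamma_integrand s t) = exp ((Re s - 1) * ln t - t).
Proof.
intros Ht; rewrite gamma_integrand_pos, Cmod_Cexp by assumption.
f_equal; Rring.
Qed.

Lemma exp_le_compat x y : (x <= y)%R -> (exp x <= exp y)%R.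
Proof. intros [H|<-]; [left; now apply exp_increasing|right; reflexivity]. Qed.

Lemma continuous_at_right {V : UniformSpace} (f : R -> V) a l :
  continuous f a -> f a = l -> filterlim f (at_right a) (locally l).
Proof.
intros Hf <-; eapply filterlim_filter_le_1; [|exact Hf].
intros P; unfold at_right, within; apply filter_imp; auto.
Qed.

Lemma exp_half_lim : filterlim (fun t => exp (- (t / 2)))%R (Rbar_locally p_infty) (locally 0%R).
Proof.
apply (is_lim_comp exp (fun t => - (t / 2))%R p_infty 0%R m_infty).
- apply is_lim_exp_m.
- apply (is_lim_ext (fun t => (-1/2) * t)%R).
  { intros; field. }
  replace m_infty with (Rbar_mult (-1/2)%R p_infty).
  + apply is_lim_scal_l, is_lim_id.
  + simpl; destruct (Rle_dec 0 (-1/2)) as [h|h]; [exfalso; lra|reflexivity].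
- now exists 0%R.
Qed.

Lemma exp_half_lim_scal c :
  filterlim (fun t => c * exp (- (t / 2)))%R (Rbar_locally p_infty) (locally 0%R).
Proof.
rewrite <- (Rmult_0_r c) at 1.
eapply filterlim_comp; [apply exp_half_lim|].
exact (filterlim_scal_r (K := R_AbsRing) (V := R_NormedModule) c 0%R).
Qed.

Lemma ln_le_sub1 x : (0 < x)%R -> (ln x <= x - 1)%R.
Proof.
intros Hx; assert (H := exp_ineq1_le (ln x)); rewrite exp_ln in H by assumption; lra.
Qed.

(** This is ln y <= y - 1 at y = t / (2p). It lets half of the decay of e^(-t) absorb the power t^p,
    leaving a multiple of e^(-t/2) as an integrable majorant. *)
Lemma p_ln_bound p : (0 <= p)%R -> exists k, forall t, (0 < t)%R -> (p * ln t <= t / 2 + k)%R.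
Proof.
intros [Hp|<-].
- exists (p * ln (2 * p) - p)%R; intros t Ht.
  replace t with (t / (2 * p) * (2 * p))%R at 1 by (field; lra).
  assert (H0 : (0 < t / (2 * p))%R) by (apply Rdiv_lt_0_compat; lra).
  rewrite ln_mult by lra.
  assert (H := ln_le_sub1 H0).
  assert (H1 : (p * ln (t / (2 * p)) <= p * (t / (2 * p) - 1))%R) by nra.
  replace (p * (t / (2 * p) - 1))%R with (t / 2 - p)%R in H1 by (field; lra).
  lra.
- exists 0%R; intros; lra.
Qed.

Lemma is_gamma_ex s : (1 <= Re s)%R -> exists v, is_gamma s v.
Proof.
intros Hs; destruct (@p_ln_bound (Re s - 1)) as [k Hk]; [lra|].
apply newton_dominated with
  (g := fun t => (exp k * exp (- (t / 2)))%R)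
  (G := fun t => (-2 * exp k * exp (- (t / 2)))%R)
  (la := (-2 * exp k)%R) (lb := 0%R).
- intros t Ht; now apply gamma_integrand_contC.
- intros t _; apply (ex_derive_continuous (K := R_AbsRing) (V := R_NormedModule)).
  auto_derive; trivial.
- intros t Ht; rewrite Cmod_gamma_integrand, <- exp_plus by assumption.
  apply exp_le_compat; specialize (Hk t Ht); lra.
- intros t _; auto_derive; [exact I|unfold Rdiv; field].
- apply continuous_at_right.
  + apply (ex_derive_continuous (K := R_AbsRing) (V := R_NormedModule)).
    auto_derive; trivial.
  + replace (- (0 / 2))%R with 0%R by field; rewrite exp_0; Rring.
- apply exp_half_lim_scal.
Qed.

(* [t^s e^(-t)] vanishes at both ends: integration by parts. *)
Lemma is_gamma_succ s v : (1 <= Re s)%R -> is_gamma s v -> is_gamma (s + 1) (s * v).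
Proof.
intros Hs Hv.
assert (HB : newton0 (fun t => s * gamma_integrand s t + -(1) * gamma_integrand (s + 1) t) 0).
{ exists (gamma_integrand (s + 1)), (RtoC 0), (RtoC 0); split; [|split; [|split]].
  - intros t Ht; eapply is_derC_eq; [apply is_derC_gamma_integrand, Ht|].
    rewrite gamma_integrand_succ by assumption.
    field; intros h; apply RtoC_inj in h; lra.
  - destruct (@p_ln_bound (Re s - 1)) as [k Hk]; [lra|].
    apply limC_norm0 with (fun t => t * exp k)%R; [typeclasses eauto| |].
    + exists (mkposreal 1 Rlt_0_1); intros t _ Ht.
      rewrite gamma_integrand_succ, Cmod_mult, Cmod_R, Rabs_pos_eq, Cmod_gamma_integrand by lra.
      apply Rmult_le_compat_l; [lra|].
      apply exp_le_compat; specialize (Hk t Ht); lra.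
    + apply continuous_at_right; [|Rring].
      apply (ex_derive_continuous (K := R_AbsRing) (V := R_NormedModule)).
      auto_derive; trivial.
  - destruct (@p_ln_bound (Re s)) as [k Hk]; [lra|].
    apply limC_norm0 with (fun t => exp k * exp (- (t / 2)))%R; [typeclasses eauto| |].
    + exists 0%R; intros t Ht.
      rewrite Cmod_gamma_integrand, <- exp_plus by lra.
      apply exp_le_compat; specialize (Hk t Ht); unfold Re in *; simpl; lra.
    + apply exp_half_lim_scal.
  - ring. }
eapply newton_val.
- eapply newton_ext;
    [|apply newton_plus; [typeclasses eauto|typeclasses eauto|
       apply newton_scal with (c := s); [typeclasses eauto|typeclasses eauto|exact Hv]|
       apply newton_scal with (c := -(1)); [typeclasses eauto|typeclasses eauto|exact HB]]].
  intros t _; simpl; ring.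
- ring.
Qed.

Lemma is_gamma_CGamma s v : is_gamma s v -> CGamma s = v.
Proof.
intros H; unfold CGamma.
apply (is_RInt_gen_unique (V := C_R_CompleteNormedModule)).
apply newton_RInt_gen; [exact H|].
intros t Ht; exact (@gamma_integrand_contC s t Ht).
Qed.

Lemma CGamma_correct s : (1 <= Re s)%R -> is_gamma s (CGamma s).
Proof.
intros Hs; destruct (@is_gamma_ex s Hs) as [v Hv].
now rewrite (is_gamma_CGamma Hv).
Qed.

Lemma CGamma_succ s : (1 <= Re s)%R -> CGamma (s + 1) = s * CGamma s.
Proof. intros Hs; now apply is_gamma_CGamma, is_gamma_succ, CGamma_correct. Qed.

Lemma CGamma_1 : CGamma 1 = 1.
Proof.
apply is_gamma_CGamma.
exists (fun t => RtoC (- exp (- t))), (RtoC (-1)), (RtoC 0); split; [|split; [|split]].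
- intros t Ht; eapply is_derC_eq.
  + apply is_derC_RtoC; auto_derive; [exact I|reflexivity].
  + rewrite gamma_integrand_pos by assumption.
    replace ((1 - 1) * ln t - t) with (RtoC (- t)) by (rewrite RtoC_opp; ring).
    rewrite Cexp_RtoC; f_equal; ring.
- apply (continuous_at_right (V := C_UniformSpace)).
  + eapply (is_derC_contC (f := fun t => RtoC (- exp (- t)))).
    apply is_derC_RtoC; auto_derive; [exact I|reflexivity].
  + f_equal; rewrite Ropp_0, exp_0; ring.
- apply limC_norm0 with (fun t => exp (- (t / 2)))%R; [typeclasses eauto| |apply exp_half_lim].
  exists 0%R; intros t Ht; rewrite Cmod_R, Rabs_Ropp, Rabs_pos_eq by (left; apply exp_pos).
  apply exp_le_compat; lra.
- rewrite <- RtoC_minus; f_equal; ring.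
Qed.

Lemma CGamma_INR n : CGamma (INR (S n)) = INR (fact n).
Proof.
induction n as [|n IH].
- exact CGamma_1.
- rewrite S_INR, RtoC_plus, CGamma_succ, IH.
  + rewrite fact_simpl, mult_INR, RtoC_mult; reflexivity.
  + rewrite S_INR; simpl Re; generalize (pos_INR n); lra.
Qed.

(** * Gamma has no zero with Re s >= 1 *)

Lemma cos_ge_quadratic th : (1 - th ^ 2 / 2 <= cos th)%R.
Proof.
assert (H : forall x, (0 <= x)%R -> (sin x ^ 2 <= x ^ 2)%R).
{ intros x Hx.
  assert (sin x <= x)%R by (destruct Hx as [Hx|<-]; [left; now apply sin_lt_x|rewrite sin_0; lra]).
  assert (- x <= sin x)%R.
  { destruct (Rle_dec 1 x) as [h|h]; [generalize (SIN_bound x); lra|].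
    assert (0 <= sin x)%R by (apply sin_ge_0; [assumption|generalize PI2_1; lra]); lra. }
  nra. }
replace th with (2 * (th / 2))%R at 2 by field.
rewrite cos_2a_sin.
assert (H1 : (sin (th / 2) ^ 2 <= (th / 2) ^ 2)%R).
{ destruct (Rle_dec 0 (th / 2)) as [h|h]; [now apply H|].
  replace (th / 2)%R with (- - (th / 2))%R by ring.
  rewrite sin_neg; assert (H2 := H (- (th / 2))%R); nra. }
nra.
Qed.

Lemma sinh_ge y : (0 <= y)%R -> (2 * y <= exp y - exp (- y))%R.
Proof.
intros Hy.
destruct (MVT_gen (fun y => exp y - exp (- y) - 2 * y)%R 0 y
  (fun y => exp y + exp (- y) - 2)%R) as [c [_ Hc]].
- intros x _; auto_derive; trivial; ring.
- intros x _; apply continuity_pt_filterlim.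
  apply (ex_derive_continuous (K := R_AbsRing) (V := R_NormedModule)
    (fun y => exp y - exp (- y) - 2 * y)%R); auto_derive; trivial.
- rewrite Ropp_0, exp_0 in Hc.
  assert (H : (exp c * exp (- c) = 1)%R) by (rewrite <- exp_plus, Rplus_opp_r; apply exp_0).
  assert (H1 := exp_pos c); assert (H2 := exp_pos (- c)).
  assert (H4 := pow2_ge_0 (exp c - exp (- c))).
  set (p := exp c) in *; set (q := exp (- c)) in *.
  assert (H3 : (2 <= p + q)%R).
  { apply Rnot_lt_le; intros h; assert ((p + q) * (p + q) < 2 * 2)%R by nra; nra. }
  nra.
Qed.

(** With r = e^(2y) this is the square of |y| <= |sinh y|. The right side is chosen because, against
    t^b e^(-t) with r proportional to t, it integrates to a combination of three consecutive Gamma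
    values. *)
Lemma ln_sqr_le r : (0 < r)%R -> (ln r ^ 2 <= r - 2 + / r)%R.
Proof.
intros Hr.
set (y := (ln r / 2)%R).
assert (E : (exp y * exp y = r)%R).
{ rewrite <- exp_plus; unfold y; replace (ln r / 2 + ln r / 2)%R with (ln r) by field.
  now apply exp_ln. }
assert (E' : (exp (- y) * exp (- y) = / r)%R).
{ rewrite <- exp_plus; unfold y; replace (- (ln r / 2) + - (ln r / 2))%R with (- ln r)%R by field.
  rewrite exp_Ropp, exp_ln by assumption; reflexivity. }
assert (E0 : (exp y * exp (- y) = 1)%R) by (rewrite <- exp_plus, Rplus_opp_r; apply exp_0).
replace (ln r) with (2 * y)%R by (unfold y; field).
rewrite <- E', <- E.
replace (exp y * exp y - 2 + exp (- y) * exp (- y))%R with ((exp y - exp (- y)) ^ 2)%R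
  by (rewrite <- (Rmult_1_r 2), <- E0; ring).
destruct (Rle_dec 0 y) as [h|h].
- assert (H := sinh_ge h); nra.
- assert (H := @sinh_ge (- y) ltac:(lra)); rewrite Ropp_involutive in H; nra.
Qed.

(* The mass of Euler's integral at [s] with large real part concentrates near
   [t = Re s], where the phase of [t^(i Im s)] is almost constant; the functional
   equation carries a zero to the right, into the region where this prevents
   cancellation. *)
Lemma CGamma_neq_0 s : (1 <= Re s)%R -> CGamma s <> 0.
Proof.
intros Hs H0.
assert (Hz := CGamma_correct s Hs); rewrite H0 in Hz.
set (tau := Im s).
(* Shifting by this n makes b = Re s + n - 1 exceed tau^2, which will make the integral in [K] have
   negative real part. *)
destruct (INR_unbounded (tau ^ 2 + 2)) as [n Hn].
assert (Hzn : is_gamma (s + INR n) 0).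
{ clear Hn; induction n as [|n IH].
  - rewrite Cplus_0_r; exact Hz.
  - rewrite S_INR, RtoC_plus, Cplus_assoc, <- (Cmult_0_r (s + INR n)).
    apply is_gamma_succ; [|exact IH].
    generalize (pos_INR n); unfold Re in *; simpl; lra. }
set (b := (Re s + INR n - 1)%R).
assert (Hb : (tau ^ 2 + 2 <= b)%R) by (unfold b; lra).
assert (Hb1 : (1 <= b)%R) by nra.
assert (G0 := CGamma_correct b Hb1); set (g := CGamma b) in *.
assert (G1 := @is_gamma_succ b _ Hb1 G0).
assert (G2 : is_gamma (b + 1 + 1) ((b + 1) * (b * g))).
{ apply is_gamma_succ; [unfold Re; simpl; lra|exact G1]. }
assert (Hb0 : RtoC (b + 1) <> 0) by (intros h; apply RtoC_inj in h; lra).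
assert (Hg : (0 < Re g)%R).
{ apply (newton_Re_pos G0); intros t Ht.
  rewrite gamma_integrand_pos, <- RtoC_minus, <- RtoC_mult, <- RtoC_minus, Cexp_RtoC by assumption.
  apply exp_pos. }
set (N := (b + 1)%R) in *.
assert (HN : (0 < N)%R) by (unfold N; lra).
(* Rotates the phase t^(i tau) into (t / N)^(i tau), which is 1 at t = N. *)
set (k := Cexp (- (tau * ln N) * Ci)).
(* With r = t / N and w = t^b e^(-t), the real part of this integrand is w (cos (tau ln r) - 1/2 +
   (tau^2 / 2)(r - 2 + 1/r)) >= w / 2, by the quadratic bounds on cos and ln. Its integral uses
   Gamma(s + n) = 0 and Gamma(b+2)/N - 2 Gamma(b+1) + N Gamma(b) = Gamma(b) for N = b + 1; it has
   negative real part since b > tau^2. *)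
assert (K : newton0 (fun t => k * gamma_integrand (s + INR n) t
  + (-(1/2) * gamma_integrand (b + 1) t + (tau ^ 2 / 2) *
      (/ N * gamma_integrand (b + 1 + 1) t
       + (-(2) * gamma_integrand (b + 1) t + N * gamma_integrand b t))))
  (g * ((tau ^ 2 - b) / 2)%R)).
{ eapply newton_val.
  - repeat first [typeclasses eauto | eassumption | apply newton_plus | apply newton_scal].
  - rewrite RtoC_div, RtoC_minus, RtoC_pow by lra.
    unfold N in *; rewrite RtoC_plus in *.
    field.
    exact Hb0. }
assert (P := newton_Re_pos K); clear K G0 G1 G2 Hz Hzn.
lapply P; [|intros t Ht].
- replace (Re (g * ((tau ^ 2 - b) / 2)%R)) with (Re g * ((tau ^ 2 - b) / 2))%R by Rring.
  nra.
- set (r := (t / N)%R).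
  assert (Hr : (0 < r)%R) by (apply Rdiv_lt_0_compat; assumption).
  set (w := exp (b * ln t - t)).
  assert (Hw : (0 < w)%R) by apply exp_pos.
  assert (W1 : gamma_integrand (b + 1) t = w).
  { rewrite gamma_integrand_pos by assumption.
    replace ((b + 1 - 1) * ln t - t) with (RtoC (b * ln t - t)) by
      (rewrite RtoC_minus, RtoC_mult; ring).
    apply Cexp_RtoC. }
  assert (W2 : gamma_integrand (b + 1 + 1) t = (t * w)%R).
  { rewrite gamma_integrand_succ, W1, RtoC_mult by assumption; reflexivity. }
  assert (W0 : gamma_integrand b t = (w / t)%R).
  { rewrite gamma_integrand_succ in W1 by assumption.
    rewrite RtoC_div by lra; rewrite <- W1; field; intros h; apply RtoC_inj in h; lra. }
  assert (Ws : k * gamma_integrand (s + INR n) t = w * Cexp ((tau * ln r)%R * Ci)).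
  { rewrite gamma_integrand_pos by assumption; unfold k, w, r.
    rewrite <- Cexp_RtoC, <- !Cexp_plus; f_equal.
    unfold Rdiv; rewrite ln_mult, ln_Rinv by (try apply Rinv_0_lt_compat; assumption).
    unfold b, tau; apply C_eq; Rring. }
  rewrite Ws, W0, W1, W2.
  replace (Re _) with (w * (cos (tau * ln r) - 1/2 + tau ^ 2 / 2 * (r - 2 + / r)))%R.
  + assert (C1 := cos_ge_quadratic (tau * ln r)).
    assert (C2 := ln_sqr_le Hr).
    assert (C3 : (0 <= tau ^ 2 / 2)%R) by nra.
    apply Rmult_lt_0_compat; [assumption|].
    assert (tau ^ 2 / 2 * ln r ^ 2 <= tau ^ 2 / 2 * (r - 2 + / r))%R by (apply Rmult_le_compat_l; assumption).
    replace ((tau * ln r) ^ 2)%R with (tau ^ 2 * ln r ^ 2)%R in C1 by ring.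
    lra.
  + replace (Cexp ((tau * ln r)%R * Ci)) with ((cos (tau * ln r), sin (tau * ln r)) : C).
    2:{ unfold Cexp; simpl. replace (tau * ln r * 0 - 0 * 1)%R with 0%R by ring.
        replace (tau * ln r * 1 + 0 * 0)%R with (tau * ln r)%R by ring.
        rewrite exp_0; apply C_eq; Rring. }
    unfold r; rewrite <- RtoC_inv by lra.
    replace (RtoC tau ^ 2 / 2) with (RtoC (tau ^ 2 / 2)) by (rewrite RtoC_div, RtoC_pow; try lra; reflexivity).
    replace (-(1/2)) with (RtoC (-(1/2))%R) by (rewrite RtoC_opp, RtoC_div by lra; reflexivity).
    simpl; field; lra.
Qed.

(** * Moments of [Rfun] *)

Definition Rpow (s : C) (z : R) : C :=
  if Rlt_dec z 1 then Cexp (s * ln (1 - z)) else 0.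

Definition qfun (x : C) (z : R) : C := 1 - (1 - x) * z.

(* [(1 - z)^s (1 - (1 - x) z)^w]; the value 0 for [z >= 1] makes it continuous at
   1 from both sides when [Re s > 0]. *)
Definition eulerian (x s w : C) (z : R) : C := Rpow s z * Cexp (w * Clog (qfun x z)).

(** On [0, 1], [qfun] is the convex combination (1 - z) + x z, and the segment from 1 to x avoids
    the closed negative half-line. *)
Lemma qfun_slit x z :
  ~ (Im x = 0%R /\ (Re x <= 0)%R) -> (0 <= z <= 1)%R -> slit (qfun x z).
Proof.
intros Hx Hz; apply slit_iff; unfold qfun; intros [H1 H2].
assert (E1 : Im (1 - (1 - x) * z) = (Im x * z)%R) by Rring.
assert (E2 : Re (1 - (1 - x) * z) = ((1 - z) + Re x * z)%R) by Rring.
rewrite E1 in H1; rewrite E2 in H2.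
apply Rmult_integral in H1; destruct H1 as [H1|H1].
- apply Hx; split; [exact H1|]; nra.
- rewrite H1 in H2; lra.
Qed.

Lemma qfun_neq_0 x z :
  ~ (Im x = 0%R /\ (Re x <= 0)%R) -> (0 <= z <= 1)%R -> qfun x z <> 0.
Proof. intros Hx Hz; now apply slit_neq_0, qfun_slit. Qed.

Lemma is_derC_qfun x z : is_derC (qfun x) z (x - 1).
Proof.
apply is_derive_ext with (fun z : R => 1 + (x - 1) * z).
{ intros t; unfold qfun; match goal with |- @eq _ ?a ?b => change (@eq C a b) end; ring. }
eapply is_derC_eq.
- apply is_derC_plus; [apply is_derC_const|].
  apply is_derC_scal, is_derC_RtoC; exact (is_derive_id (K := R_AbsRing) z).
- unfold one; simpl; match goal with |- @eq _ ?a ?b => change (@eq C a b) end; ring.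
Qed.

Lemma is_derC_Rpow s z : (z < 1)%R -> is_derC (Rpow s) z (- (s / (1 - z)%R) * Rpow s z).
Proof.
intros Hz.
apply is_derive_ext_loc with (fun z => Cexp (s * ln (1 - z))).
{ exists (mkposreal (1 - z) (proj2 (Rlt_0_minus _ _) Hz)); intros y Hy.
  revert Hy; unfold ball; simpl; unfold AbsRing_ball, abs, minus, plus, opp; simpl.
  intros Hy; apply Rabs_lt_between in Hy; unfold Rpow.
  destruct (Rlt_dec y 1) as [_|h]; [reflexivity|exfalso; lra]. }
eapply is_derC_eq.
- apply is_derC_Cexp, is_derC_scal, is_derC_RtoC.
  auto_derive; [lra|reflexivity].
- unfold Rpow; destruct (Rlt_dec z 1) as [_|h]; [|lra].
  rewrite RtoC_mult, RtoC_opp, RtoC_inv by lra.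
  match goal with |- @eq _ ?a ?b => change (@eq C a b) end.
  unfold Rminus; field; intros h; apply RtoC_inj in h; lra.
Qed.

Lemma Rpow_lim_1 s : (0 < Re s)%R -> limC (Rpow s) (locally 1%R) 0.
Proof.
intros Hs; apply limC_norm0 with (fun z => Cmod (Rpow s z)); [typeclasses eauto| |].
{ apply filter_forall; intros; apply Rle_refl. }
apply filterlim_locally; intros e.
exists (mkposreal (exp (ln e / Re s)) (exp_pos _)); intros y.
unfold ball; simpl; unfold AbsRing_ball, abs, minus, plus, opp; simpl; intros Hy.
rewrite Ropp_0, Rplus_0_r, Rabs_pos_eq by apply Cmod_ge_0.
unfold Rpow; destruct (Rlt_dec y 1) as [h|h]; [|rewrite Cmod_0; apply cond_pos].
rewrite Cmod_Cexp, <- (exp_ln e) by apply cond_pos.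
apply exp_increasing.
replace (Re (s * ln (1 - y))) with (Re s * ln (1 - y))%R by Rring.
rewrite Rabs_left in Hy by lra.
assert (H : (ln (1 - y) < ln e / Re s)%R).
{ rewrite <- (ln_exp (ln e / Re s)); apply ln_increasing; lra. }
apply (Rmult_lt_compat_l (Re s)) in H; [|exact Hs].
replace (Re s * (ln e / Re s))%R with (ln e) in H by (field; lra); exact H.
Qed.

Lemma is_derC_eulerian x s w z :
  ~ (Im x = 0%R /\ (Re x <= 0)%R) -> (0 <= z < 1)%R ->
  is_derC (eulerian x s w) z
    ((- (s / (1 - z)%R) - w * (1 - x) / qfun x z) * eulerian x s w z).
Proof.
intros Hx Hz; eapply is_derC_eq.
- apply is_derC_mult; [apply is_derC_Rpow; lra|].
  apply is_derC_Cexp, is_derC_scal, is_derC_Clog; [apply is_derC_qfun|].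
  apply qfun_slit; [exact Hx|lra].
- assert (Hq := @qfun_neq_0 x z Hx ltac:(lra)).
  unfold eulerian; match goal with |- @eq _ ?a ?b => change (@eq C a b) end.
  field; split; [exact Hq|]; intros h; apply RtoC_inj in h; lra.
Qed.

Lemma eulerian_1 x s w : eulerian x s w 1 = 0.
Proof.
unfold eulerian, Rpow; destruct (Rlt_dec 1 1) as [h|_]; [lra|ring].
Qed.

Lemma eulerian_0 x s w : eulerian x s w 0 = 1.
Proof.
unfold eulerian, Rpow, qfun; destruct (Rlt_dec 0 1) as [_|h]; [|lra].
replace (1 - (1 - x) * 0%R) with (RtoC 1) by ring.
rewrite Clog_pos, Rminus_0_r, ln_1, !Cmult_0_r, Cexp_0 by lra; ring.
Qed.

Lemma eulerian_contC x s w z :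
  ~ (Im x = 0%R /\ (Re x <= 0)%R) -> (0 < Re s)%R -> (0 <= z <= 1)%R ->
  contC (eulerian x s w) z.
Proof.
intros Hx Hs Hz; destruct (Rlt_dec z 1) as [h|h].
- exact (is_derC_contC (@is_derC_eulerian x s w z Hx ltac:(lra))).
- replace z with 1%R by lra; unfold continuous; rewrite eulerian_1.
  rewrite <- (Cmult_0_l (Cexp (w * Clog (qfun x 1)))).
  apply limC_mult; [typeclasses eauto|now apply Rpow_lim_1|].
  apply (is_derC_contC (f := fun z => Cexp (w * Clog (qfun x z)))
    (l := w * ((x - 1) / qfun x 1) * Cexp (w * Clog (qfun x 1)))).
  apply is_derC_Cexp, is_derC_scal, is_derC_Clog; [apply is_derC_qfun|].
  apply qfun_slit; [exact Hx|lra].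
Qed.

Lemma eulerian_lim_0 x s w : ~ (Im x = 0%R /\ (Re x <= 0)%R) -> (0 < Re s)%R ->
  limC (eulerian x s w) (at_right 0%R) 1.
Proof.
intros Hx Hs; apply (continuous_at_right (V := C_UniformSpace)); [|apply eulerian_0].
apply eulerian_contC; [exact Hx|exact Hs|lra].
Qed.

Lemma eulerian_lim_1 x s w : ~ (Im x = 0%R /\ (Re x <= 0)%R) -> (0 < Re s)%R ->
  limC (eulerian x s w) (at_left 1%R) 0.
Proof.
intros Hx Hs; rewrite <- (eulerian_1 x s w).
eapply filterlim_filter_le_1; [|apply eulerian_contC; [exact Hx|exact Hs|lra]].
intros P; unfold at_left, within; apply filter_imp; auto.
Qed.

Lemma eulerian_shift x s w n z :
  ~ (Im x = 0%R /\ (Re x <= 0)%R) -> (0 <= z <= 1)%R ->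
  eulerian x s (w + INR n) z = eulerian x s w z * qfun x z ^ n.
Proof.
intros Hx Hz; unfold eulerian.
rewrite Cmult_plus_distr_r, Cexp_plus, Cexp_INR_mult, Cexp_Clog.
- ring.
- now apply qfun_neq_0.
Qed.

(** The bound [1 <= n] matters for z >= 1, where [Rpow] is 0 whatever the exponent while the power 0
    of 0 is 1. *)
Lemma eulerian_pow x s w n z : (1 <= n)%nat ->
  eulerian x s w z ^ n = eulerian x (INR n * s) (INR n * w) z.
Proof.
intros Hn; unfold eulerian, Rpow; rewrite Cpow_mult_l.
replace (INR n * w * Clog (qfun x z)) with (INR n * (w * Clog (qfun x z))) by ring.
rewrite Cexp_INR_mult; f_equal.
destruct (Rlt_dec z 1) as [h|h].
- rewrite <- Cmult_assoc, Cexp_INR_mult; reflexivity.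
- destruct n as [|n]; [lia|]; rewrite Cpow_S; ring.
Qed.

Lemma Rfun_eulerian x nu z :
  ~ (Im x = 0%R /\ (Re x <= 0)%R) -> (Re nu < 0)%R -> (0 <= z <= 1)%R ->
  Rfun x nu z = eulerian x (- nu) (nu - 1) z.
Proof.
intros Hx Hnu Hz; unfold Rfun, eulerian; f_equal.
- unfold Rpow; rewrite <- RtoC_minus.
  destruct (Rlt_dec z 1) as [h|h]; [apply Cpower_pos; lra|].
  (* At z = 1 the convention 0^w = 0 applies, because Re nu < 0 excludes w = 0. *)
  replace (1 - z)%R with 0%R by lra; unfold Cpower.
  destruct (Ceq_dec 0 0) as [_|h']; [|now elim h'].
  destruct (Ceq_dec (- nu) 0) as [h'|_]; [|reflexivity].
  exfalso; apply (f_equal Re) in h'; simpl in h'; unfold Re in Hnu; lra.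
- assert (Hq := @qfun_neq_0 x z Hx Hz); fold (qfun x z); unfold Cpower.
  destruct (Ceq_dec (qfun x z) 0) as [h|_]; [contradiction|reflexivity].
Qed.

(* The Mobius change of variable [t = (1 - z) / (1 - (1 - x) z)] turns the
   integral of [Rfun^b] times a polynomial into Beta integrals; [mobius_pow x s]
   is [t^s] and [mobius_dlog x] is [t' / t]. *)
Definition mobius_pow (x s : C) (z : R) : C := eulerian x s (- s) z.

Definition mobius_dlog (x : C) (z : R) : C := - (x / (qfun x z * (1 - z)%R)).

Lemma is_derC_mobius_pow x s z :
  ~ (Im x = 0%R /\ (Re x <= 0)%R) -> (0 < z < 1)%R ->
  is_derC (mobius_pow x s) z (s * mobius_dlog x z * mobius_pow x s z).
Proof.
intros Hx Hz; eapply is_derC_eq.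
- exact (@is_derC_eulerian x s (- s) z Hx ltac:(lra)).
- assert (Hq := @qfun_neq_0 x z Hx ltac:(lra)).
  assert (H1 : RtoC (1 - z) <> 0) by (intros h; apply RtoC_inj in h; lra).
  unfold mobius_dlog, mobius_pow; match goal with |- @eq _ ?a ?b => change (@eq C a b) end.
  f_equal; field_simplify_eq; [|tauto].
  unfold qfun; rewrite RtoC_minus; ring.
Qed.

(** No branch question arises: t^s is built from the difference of the logarithms of 1 - z and q,
    not from a logarithm of the quotient. *)
Lemma mobius_pow_plus x s r z : (z < 1)%R ->
  mobius_pow x (s + r) z = mobius_pow x s z * mobius_pow x r z.
Proof.
intros Hz; unfold mobius_pow, eulerian, Rpow; destruct (Rlt_dec z 1) as [_|h]; [|lra].
replace (Cexp ((s + r) * ln (1 - z)))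
  with (Cexp (s * ln (1 - z)) * Cexp (r * ln (1 - z)))
  by (rewrite <- Cexp_plus; f_equal; ring).
replace (Cexp (- (s + r) * Clog (qfun x z)))
  with (Cexp (- s * Clog (qfun x z)) * Cexp (- r * Clog (qfun x z)))
  by (rewrite <- Cexp_plus; f_equal; ring).
ring.
Qed.

Lemma mobius_pow_1 x z : ~ (Im x = 0%R /\ (Re x <= 0)%R) -> (0 < z < 1)%R ->
  mobius_pow x 1 z = (1 - z)%R / qfun x z.
Proof.
intros Hx Hz; unfold mobius_pow, eulerian, Rpow; destruct (Rlt_dec z 1) as [_|h]; [|lra].
rewrite Cmult_1_l, Cexp_RtoC, exp_ln by lra.
replace (- (1) * Clog (qfun x z)) with (- Clog (qfun x z)) by ring.
rewrite Cexp_opp, Cexp_Clog; [reflexivity|apply qfun_neq_0; [exact Hx|lra]].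
Qed.

Lemma mobius_pow_INR x n z : ~ (Im x = 0%R /\ (Re x <= 0)%R) -> (0 < z < 1)%R ->
  mobius_pow x (INR n) z = ((1 - z)%R / qfun x z) ^ n.
Proof.
intros Hx Hz; induction n as [|n IH].
- unfold mobius_pow, eulerian, Rpow; destruct (Rlt_dec z 1) as [_|h]; [|lra].
  change (INR 0) with 0%R; rewrite Copp_0, !Cmult_0_l, Cexp_0; simpl; ring.
- rewrite S_INR, RtoC_plus, mobius_pow_plus, IH, mobius_pow_1, Cpow_S by (assumption || lra).
  ring.
Qed.

(** * Pochhammer symbols and Beta integrals *)

Lemma poch_Sl a m : poch a (S m) = a * poch (a + 1) m.
Proof.
induction m as [|m IH]; [simpl; ring|].
change (poch a (S (S m))) with (poch a (S m) * (a + INR (S m))).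
rewrite IH; simpl poch; rewrite S_INR, RtoC_plus; ring.
Qed.

Lemma poch_add a m k : poch a (m + k) = poch a m * poch (a + INR m) k.
Proof.
induction k as [|k IH]; [rewrite Nat.add_0_r; simpl; ring|].
rewrite Nat.add_succ_r; simpl poch; rewrite IH, plus_INR, RtoC_plus; ring.
Qed.

Lemma poch_neq_0 a m : (0 < Re a)%R -> poch a m <> 0.
Proof.
intros Ha; induction m as [|m IH]; simpl.
- intros h; apply RtoC_inj in h; lra.
- apply Cmult_neq_0; [exact IH|].
  intros h; apply (f_equal Re) in h; generalize (pos_INR m); simpl in h; unfold Re in Ha; lra.
Qed.

Lemma poch_opp_INR n m : (m <= n)%nat ->
  poch (- INR n) m = (- (1)) ^ m * INR (fact n) / INR (fact (n - m)).
Proof.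
assert (F : forall k, RtoC (INR (fact k)) <> 0)
  by (intros k h; apply RtoC_inj in h; generalize (INR_fact_neq_0 k); auto).
induction m as [|m IH]; intros Hm.
- rewrite Nat.sub_0_r; simpl; field; apply F.
- simpl poch; rewrite IH by lia.
  assert (E : (n - m = S (n - S m))%nat) by lia.
  assert (E2 : INR n = (INR (n - m) + INR m)%R) by (rewrite <- plus_INR; f_equal; lia).
  rewrite E2, E, fact_simpl, mult_INR, RtoC_mult, RtoC_plus, Cpow_S.
  field; split; [apply F|].
  intros h; apply RtoC_inj in h; generalize (pos_INR (n - S m)); rewrite S_INR in h; lra.
Qed.

(** In the variable t this is the integral of t^(s-1) (1 - t)^k, but from t = 1 to t = 0, whence the
    minus sign. The induction on [k] integrates by parts and moves from s to s + 1, so [s] is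
    quantified after [k]. *)
Lemma newton_beta x k : ~ (Im x = 0%R /\ (Re x <= 0)%R) -> forall s, (0 < Re s)%R ->
  newton1 (fun z => mobius_pow x s z * (1 - mobius_pow x 1 z) ^ k * mobius_dlog x z)
    (- (INR (fact k) / poch s (S k))).
Proof.
intros Hx; induction k as [|k IH]; intros s Hs.
- assert (H0 : s <> 0) by (intros ->; simpl in Hs; lra).
  assert (N : newton1 (fun z => s * mobius_dlog x z * mobius_pow x s z) (0 - 1)).
  { exists (mobius_pow x s), (RtoC 1), (RtoC 0); split; [|split; [|split]].
    - intros; now apply is_derC_mobius_pow.
    - now apply eulerian_lim_0.
    - now apply eulerian_lim_1.
    - reflexivity. }
  eapply newton_val; [eapply newton_ext|].
  2: apply newton_scal with (c := / s); [typeclasses eauto|typeclasses eauto|exact N].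
  + intros t _; simpl; field; exact H0.
  + simpl; rewrite Cplus_0_r; field; exact H0.
- assert (H0 : s <> 0) by (intros ->; simpl in Hs; lra).
  assert (Hs1 : (0 < Re (s + 1))%R) by (unfold Re in *; simpl; lra).
  (* Derivative of t^s (1 - t)^(k+1), which vanishes at both ends. *)
  assert (N : newton1 (fun z =>
    s * (mobius_pow x s z * (1 - mobius_pow x 1 z) ^ S k * mobius_dlog x z)
    - INR (S k) * (mobius_pow x (s + 1) z * (1 - mobius_pow x 1 z) ^ k * mobius_dlog x z))
    (0 - 0)).
  { exists (fun z => mobius_pow x s z * (1 + -(1) * mobius_pow x 1 z) ^ S k), (RtoC 0), (RtoC 0);
      split; [|split; [|split]].
    - intros t Ht; eapply is_derC_eq.
      + apply is_derC_mult; [now apply is_derC_mobius_pow|].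
        apply is_derC_pow, is_derC_plus; [apply is_derC_const|].
        apply is_derC_scal; now apply is_derC_mobius_pow.
      + rewrite mobius_pow_plus by lra.
        replace (S k - 1)%nat with k by lia.
        match goal with |- @eq _ ?a ?b => change (@eq C a b) end.
        replace (1 - mobius_pow x 1 t) with (1 + - (1) * mobius_pow x 1 t) by ring.
        rewrite !Cpow_S; ring.
    - replace (RtoC 0) with (1 * ((1 + -(1) * 1) * (1 + - (1) * 1) ^ k)) by ring.
      apply limC_mult; [typeclasses eauto|now apply eulerian_lim_0|].
      assert (L : limC (fun z => 1 + -(1) * mobius_pow x 1 z) (at_right 0%R) (1 + -(1) * 1)).
      { apply limC_plus; [typeclasses eauto|solve_limC|].
        apply limC_mult; [typeclasses eauto|solve_limC|].
        apply eulerian_lim_0; [exact Hx|simpl; lra]. }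
      exact (limC_pow (S k) L).
    - replace (RtoC 0) with (0 * ((1 + -(1) * 0) ^ S k)) by ring.
      apply limC_mult; [typeclasses eauto|now apply eulerian_lim_1|].
      apply limC_pow; [typeclasses eauto|].
      apply limC_plus; [typeclasses eauto|solve_limC|].
      apply limC_mult; [typeclasses eauto|solve_limC|].
      apply eulerian_lim_1; [exact Hx|simpl; lra].
    - reflexivity. }
  eapply newton_val; [eapply newton_ext|].
  2: apply newton_scal with (c := / s); [typeclasses eauto|typeclasses eauto|];
     apply newton_plus; [typeclasses eauto|typeclasses eauto|exact N|];
     apply newton_scal with (c := RtoC (INR (S k))); [typeclasses eauto|typeclasses eauto|exact (IH _ Hs1)].
  + intros t _; cbv beta; field; exact H0.
  + rewrite (poch_Sl s), fact_simpl, mult_INR, RtoC_mult.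
    field; split; [apply poch_neq_0, Hs1|exact H0].
Qed.

(** * Finite sums, binomial identities and the closed form of the moments *)

Lemma RtoC_sum_n (f : nat -> R) n :
  RtoC (sum_n f n) = sum_n (G := C_AbelianMonoid) (fun k => RtoC (f k)) n.
Proof.
induction n as [|n IH]; [now rewrite !sum_O|].
rewrite !sum_Sn, <- IH; apply RtoC_plus.
Qed.

Lemma Csum_n_scal (c : C) (f : nat -> C) n :
  sum_n (G := C_AbelianMonoid) (fun k => c * f k) n = c * sum_n (G := C_AbelianMonoid) f n.
Proof.
induction n as [|n IH]; [now rewrite !sum_O|].
rewrite !sum_Sn, IH; unfold plus; simpl; ring.
Qed.

Lemma Csum_n_ext (f g : nat -> C) n :
  (forall k, (k <= n)%nat -> f k = g k) ->
  sum_n (G := C_AbelianMonoid) f n = sum_n (G := C_AbelianMonoid) g n.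
Proof. intros H; now apply sum_n_ext_loc. Qed.

Lemma INR_fact_neq_0_C n : RtoC (INR (fact n)) <> 0.
Proof. intros h; apply RtoC_inj in h; revert h; apply INR_fact_neq_0. Qed.

Lemma binomial_sum_1 n y :
  sum_f_R0 (fun m => Binomial.C n m * (1 - y) ^ m * y ^ (n - m))%R n = 1%R.
Proof. rewrite <- binomial; replace (1 - y + y)%R with 1%R by ring; apply pow1. Qed.

(** Here n - m counts the successes, of probability y. The term m = n vanishes and the others obey
    (n - m) C(n, m) = n C(n - 1, m). *)
Lemma binomial_sum_mean n y :
  sum_f_R0 (fun m => INR (n - m) * (Binomial.C n m * (1 - y) ^ m * y ^ (n - m)))%R n
  = (INR n * y)%R.
Proof.
destruct n as [|n]; [simpl; ring|].
rewrite tech5, Nat.sub_diag, !Rmult_0_l, Rplus_0_r.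
transitivity (INR (S n) * y * sum_f_R0 (fun m => Binomial.C n m * (1 - y) ^ m * y ^ (n - m)) n)%R;
  [|rewrite binomial_sum_1; ring].
rewrite scal_sum.
apply sum_eq; intros m Hm.
replace (S n - m)%nat with (S (n - m)) by lia.
unfold Binomial.C; replace (S n - m)%nat with (S (n - m)) by lia.
rewrite !fact_simpl, !mult_INR; simpl pow.
field; repeat split; try apply INR_fact_neq_0.
rewrite S_INR; generalize (pos_INR (n - m)); lra.
Qed.

(** For n = b - l the weight l + n - m is b - m, the factor that turns (b - 1 - m)! into (b - m)! in
    the hypergeometric coefficients. *)
Lemma binomial_sum_affine l n y :
  sum_n (fun m => (INR (l + n - m) * (Binomial.C n m * (1 - y) ^ m * y ^ (n - m)))%R) n
  = (INR l + INR n * y)%R.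
Proof.
rewrite sum_n_Reals; match goal with |- @eq _ ?a ?b => change (@eq R a b) end.
transitivity (INR l * sum_f_R0 (fun m => Binomial.C n m * (1 - y) ^ m * y ^ (n - m)) n + INR n * y)%R;
  [|rewrite binomial_sum_1; ring].
rewrite <- (binomial_sum_mean n y), scal_sum, <- plus_sum.
apply sum_eq; intros m Hm.
replace (l + n - m)%nat with (l + (n - m))%nat by lia; rewrite plus_INR; ring.
Qed.

Lemma CGamma_add s m : (1 <= Re s)%R -> CGamma (s + INR m) = poch s m * CGamma s.
Proof.
intros Hs; induction m as [|m IH].
- simpl; rewrite Cplus_0_r; ring.
- rewrite S_INR, RtoC_plus, Cplus_assoc, CGamma_succ, IH.
  + simpl; ring.
  + generalize (pos_INR m); unfold Re in *; simpl; lra.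
Qed.

(* In terms of [w = -b nu]: the Gamma factors telescope and all that is left is
   the polynomial in [x] with the Beta-type coefficients
   [(b - m)! / (w + m)_(b - m)]. *)
Lemma Qcoef_beta_sum (x nu : C) b l :
  x <> 0 -> x <> 1 -> (Re nu < 0)%R -> (1 <= l <= b)%nat ->
  Qcoef x nu b l =
  - nu / (1 - x) * sum_n (G := C_AbelianMonoid) (fun m =>
     / x ^ (b - 1) * x ^ m * INR (b - m) * Binomial.C (b - l) m *
     (- (INR (fact (b - 1 - m)) / poch (INR b * - nu + INR m) (b - m)))) (b - l).
Proof.
intros Hx0 Hx1 Hnu Hl.
assert (H1x : 1 - x <> 0).
{ intros h; apply Hx1; replace x with (1 - (1 - x)) by ring; rewrite h; ring. }
set (w := INR b * - nu).
assert (HbR : (1 <= INR b)%R) by (apply (le_INR 1); lia).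
assert (Hw : (0 < Re w)%R).
{ replace (Re w) with (INR b * - Re nu)%R by (unfold w; Rring); nra. }
assert (Hw1 : (1 <= Re (1 + w))%R) by (change (1 <= 1 + Re w)%R; lra).
unfold Qcoef, hypergeom_poly.
replace (1 - INR b * nu) with (1 + w) by (unfold w; ring).
replace (- (INR b * nu)) with w by (unfold w; ring).
destruct b as [|b']; [lia|].
replace (S b' - 1)%nat with b' by lia.
replace (INR (S b') - INR (S b') * nu) with (1 + w + INR b')
  by (unfold w; rewrite S_INR, RtoC_plus; ring).
rewrite CGamma_INR, CGamma_add by exact Hw1.
(* Gamma(1 + w) occurs in the numerator and, times (1 + w)_(b'), in the denominator; it cancels only
   because it is nonzero. *)
assert (HG := CGamma_neq_0 Hw1).
assert (Hp := poch_neq_0 (1 + w) b' ltac:(lra)).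
rewrite <- !Csum_n_scal; apply Csum_n_ext; intros m Hm.
rewrite !poch_opp_INR by lia.
(* Splitting (w)_b at m and peeling off its first factor gives (w)_m = w (1 + w)_(b-1) / (w +
   m)_(b-m). The factor (1 + w)_(b-1) cancels against the Gamma quotient, and w / b is the - nu of
   the statement. *)
assert (Hpm : poch w (S b') = poch w m * poch (w + INR m) (S b' - m)).
{ rewrite <- poch_add; f_equal; lia. }
rewrite poch_Sl, (Cplus_comm w 1) in Hpm.
assert (Hwm : (0 < Re (w + INR m))%R)
  by (change (0 < Re w + INR m)%R; generalize (pos_INR m); lra).
assert (Hq := poch_neq_0 (w + INR m) (S b' - m) Hwm).
assert (Hw0 : w <> 0) by (intros h; rewrite h in Hw; simpl in Hw; lra).
assert (Hpw : poch w m = w * poch (1 + w) b' / poch (w + INR m) (S b' - m))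
  by (rewrite Hpm; field; exact Hq).
rewrite Hpw.
replace (Binomial.C (S b' - l) m)
  with (INR (fact (S b' - l)) / (INR (fact m) * INR (fact (S b' - l - m))))%R by reflexivity.
assert (F := INR_fact_neq_0_C).
assert (Hbm : (S b' - m = S (b' - m))%nat) by lia.
rewrite RtoC_div, RtoC_mult by (apply Rmult_integral_contrapositive; split; apply INR_fact_neq_0).
rewrite Hbm in *; rewrite (fact_simpl (b' - m)), (fact_simpl b'), !mult_INR, !RtoC_mult.
assert (HS : RtoC (INR (S b')) <> 0) by (intros h; apply RtoC_inj in h; lra).
assert (HSm : RtoC (INR (S (b' - m))) <> 0).
{ intros h; apply RtoC_inj in h; rewrite S_INR in h; generalize (pos_INR (b' - m)); lra. }
assert (Hxp := Cpow_nz x b' Hx0).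
assert (Hm1 : (- (1)) ^ m <> 0) by (apply Cpow_nz; intros h; apply (f_equal Re) in h; simpl in h; lra).
assert (Enu : - nu = w / INR (S b')) by (unfold w; field; exact HS).
rewrite Enu; clear Enu; clearbody w.
field; repeat split; auto.
Qed.

(** The integrand is split as an exact derivative ([N2], total 0) plus a sum of Beta integrands
    ([N1]). Both contain (1 - z)^(w - 1), unbounded at 1 when Re w < 1; these singular parts cancel
    in the sum. *)
Lemma newton_moment (x nu : C) b l :
  ~ (Im x = 0%R /\ (Re x <= 0)%R) -> x <> 1 -> (Re nu < 0)%R -> (1 <= l <= b)%nat ->
  newton1 (fun z => Rfun x nu z ^ b *
    ((1 - INR (b - l)) * z ^ l - cst x nu * INR l * z ^ (l - 1)))
    (Qcoef x nu b l).
Proof.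
intros Hx Hx1 Hnu Hl.
assert (Hx0 : x <> 0) by (intros ->; apply Hx; simpl; split; [reflexivity|lra]).
assert (H1x : 1 - x <> 0).
{ intros h; apply Hx1; replace x with (1 - (1 - x)) by ring; rewrite h; ring. }
set (w := INR b * - nu).
assert (HbR : (1 <= INR b)%R) by (apply (le_INR 1); lia).
assert (Hw : (0 < Re w)%R).
{ replace (Re w) with (INR b * - Re nu)%R by (unfold w; Rring); nra. }
assert (N1 : newton1 (fun z => - nu / (1 - x) * sum_n (G := C_AbelianMonoid) (fun m =>
     / x ^ (b - 1) * x ^ m * INR (b - m) * Binomial.C (b - l) m *
     (mobius_pow x (w + INR m) z * (1 - mobius_pow x 1 z) ^ (b - 1 - m) * mobius_dlog x z)) (b - l))
   (Qcoef x nu b l)).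
{ rewrite Qcoef_beta_sum by assumption.
  apply newton_scal; [typeclasses eauto|typeclasses eauto|].
  apply newton_sum_n with (f := fun m z =>
     / x ^ (b - 1) * x ^ m * INR (b - m) * Binomial.C (b - l) m *
     (mobius_pow x (w + INR m) z * (1 - mobius_pow x 1 z) ^ (b - 1 - m) * mobius_dlog x z));
   [typeclasses eauto|typeclasses eauto|].
  intros m Hm; apply newton_scal; [typeclasses eauto|typeclasses eauto|].
  replace (b - m)%nat with (S (b - 1 - m)) by lia.
  apply newton_beta; [exact Hx|].
  change (0 < Re w + INR m)%R; generalize (pos_INR m); lra. }
set (e := fun z => eulerian x w (- w - INR b) z).
(* Derivative of - z^l t^w q^(1-b) / (1 - x). It vanishes at 0 because l >= 1 and at 1 because Re w
   > 0. *)
assert (N2 : newton1 (fun z => - / (1 - x) *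
   ((INR l * z ^ (l - 1)) * (e z * qfun x z) +
    z ^ l * ((- (w / (1 - z)%R) - (- w - INR b + 1) * (1 - x) / qfun x z) * (e z * qfun x z))))
   (-/ (1 - x) * (1 ^ l * 0 - 0 ^ l * 1))).
{ apply newton_scal with (v := 1 ^ l * 0 - 0 ^ l * 1) (f := fun z : R =>
   (INR l * z ^ (l - 1)) * (e z * qfun x z) +
    z ^ l * ((- (w / (1 - z)%R) - (- w - INR b + 1) * (1 - x) / qfun x z) * (e z * qfun x z)));
   [typeclasses eauto|typeclasses eauto|].
  exists (fun z : R => RtoC z ^ l * eulerian x w (- w - INR b + 1) z), (0 ^ l * 1), (1 ^ l * 0);
    split; [|split; [|split]].
  - intros z Hz; eapply is_derC_eq.
    + apply is_derC_mult; [apply is_derC_pow, is_derC_RtoC; exact (is_derive_id (K := R_AbsRing) z)|].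
      apply is_derC_eulerian; [exact Hx|lra].
    + replace (eulerian x w (- w - INR b + 1) z) with (e z * qfun x z).
      2:{ unfold e; rewrite <- (Cpow_1_r (qfun x z)), <- eulerian_shift; [reflexivity|exact Hx|lra]. }
      unfold one; simpl; match goal with |- @eq _ ?a ?b => change (@eq C a b) end; ring.
  - apply limC_mult; [typeclasses eauto| |now apply eulerian_lim_0].
    apply limC_pow; [typeclasses eauto|].
    apply (continuous_at_right (V := C_UniformSpace)); [|reflexivity].
    apply (is_derC_contC (f := RtoC) (l := RtoC 1)), is_derC_RtoC.
    exact (is_derive_id (K := R_AbsRing) 0%R).
  - apply limC_mult; [typeclasses eauto| |now apply eulerian_lim_1].
    apply limC_pow; [typeclasses eauto|].
    eapply filterlim_filter_le_1; [|apply (is_derC_contC (f := RtoC) (t := 1%R) (l := RtoC 1)), is_derC_RtoC; exact (is_derive_id (K := R_AbsRing) 1%R)].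
    intros P; unfold at_left, within; apply filter_imp; auto.
  - reflexivity. }
assert (N := newton_plus N2 N1).
eapply newton_val; [eapply newton_ext; [|exact N]|].
- intros z Hz; cbv beta.
  assert (Hq := @qfun_neq_0 x z Hx ltac:(lra)).
  assert (Hz1 : RtoC (1 - z) <> 0) by (intros h; apply RtoC_inj in h; lra).
  assert (HR : Rfun x nu z ^ b = e z).
  { rewrite Rfun_eulerian, eulerian_pow by (assumption || lra || lia).
    unfold e, w; f_equal; ring. }
  set (n := (b - l)%nat).
  (* Since t^w = e q^b and 1 - t = x z / q, all powers of q cancel and those of x reduce to one,
     independent of m. What remains is z^(l-1) times the binomial mean. *)
  assert (HS : sum_n (G := C_AbelianMonoid) (fun m =>
     / x ^ (b - 1) * x ^ m * INR (b - m) * Binomial.C n m *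
     (mobius_pow x (w + INR m) z * (1 - mobius_pow x 1 z) ^ (b - 1 - m) * mobius_dlog x z)) n
     = - (x / (1 - z)%R) * e z * z ^ (l - 1) * (INR l + INR n * z)%R).
  { rewrite <- (binomial_sum_affine l n z), RtoC_sum_n, <- Csum_n_scal.
    apply Csum_n_ext; intros m Hm.
    rewrite mobius_pow_plus, mobius_pow_INR, mobius_pow_1 by (assumption || lra).
    assert (Hmw : mobius_pow x w z = e z * qfun x z ^ b).
    { unfold e; rewrite <- eulerian_shift by (assumption || lra).
      unfold mobius_pow; f_equal; ring. }
    rewrite Hmw.
    replace (1 - (1 - z)%R / qfun x z) with (x * z / qfun x z).
    2:{ field_simplify_eq; [|exact Hq]; unfold qfun; rewrite RtoC_minus; ring. }
    replace (l + n - m)%nat with (b - m)%nat by (unfold n; lia).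
    rewrite !RtoC_mult, !RtoC_pow.
    unfold Cdiv; rewrite !Cpow_mult_l, !Cpow_inv by exact Hq.
    set (p := (n - m)%nat); set (k := (l - 1)%nat).
    replace (b - 1)%nat with (m + (k + p))%nat by (unfold p, n, k; lia).
    replace (m + (k + p) - m)%nat with (k + p)%nat by lia.
    replace (qfun x z ^ b) with (qfun x z * (qfun x z ^ m * (qfun x z ^ k * qfun x z ^ p))).
    2:{ rewrite <- !Cpow_add_r, <- Cpow_S; f_equal; unfold p, n, k; lia. }
    unfold mobius_dlog; rewrite !Cpow_add_r.
    assert (A : forall j, qfun x z ^ j <> 0) by (intros; now apply Cpow_nz).
    assert (A' : forall j, x ^ j <> 0) by (intros; now apply Cpow_nz).
    field; repeat split; auto. }
  rewrite HS, HR; clear HS.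
  replace (RtoC z ^ l) with (RtoC z * z ^ (l - 1))
    by (rewrite <- Cpow_S; f_equal; lia).
  assert (Hbl : INR b = (INR l + INR n)%R) by (rewrite <- plus_INR; f_equal; unfold n; lia).
  assert (Ew : w = - ((INR l + INR n) * nu)) by (unfold w; rewrite Hbl, RtoC_plus; ring).
  rewrite Hbl, Ew, !RtoC_plus, !RtoC_mult; unfold cst.
  field_simplify_eq; [|tauto].
  unfold qfun; rewrite RtoC_minus; ring.
- replace (0 ^ l) with (RtoC 0) by (destruct l as [|l]; [lia|rewrite Cpow_S; ring]).
  ring.
Qed.

(** * Complex power series *)

Lemma Re_sum_n a n : Re (Csum a n) = sum_n (fun k => Re (a k)) n.
Proof.
induction n as [|n IH]; [now rewrite !sum_O|].
rewrite !sum_Sn, <- IH; reflexivity.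
Qed.

Lemma Im_sum_n a n : Im (Csum a n) = sum_n (fun k => Im (a k)) n.
Proof.
induction n as [|n IH]; [now rewrite !sum_O|].
rewrite !sum_Sn, <- IH; reflexivity.
Qed.

Lemma is_Cseries_iff (a : nat -> C) l :
  is_Cseries a l <->
  is_series (fun n => Re (a n)) (Re l) /\ is_series (fun n => Im (a n)) (Im l).
Proof.
unfold is_series; split.
- intros H; destruct (proj1 (limC_iff (F := eventually) (Csum a) l) H) as [H1 H2]; split; eapply filterlim_ext; try eassumption; intros n.
  + apply Re_sum_n.
  + apply Im_sum_n.
- intros [H1 H2]; apply (limC_iff (F := eventually) (Csum a) l).
  split; eapply filterlim_ext; try eassumption; intros n; symmetry.
  + apply Re_sum_n.
  + apply Im_sum_n.
Qed.

Lemma is_Cseries_ext (a b : nat -> C) l :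
  (forall n, a n = b n) -> is_Cseries a l -> is_Cseries b l.
Proof. apply is_series_ext. Qed.

Lemma is_Cseries_unique (a : nat -> C) l m : is_Cseries a l -> is_Cseries a m -> l = m.
Proof.
intros H1 H2; exact (filterlim_locally_unique (V := C_NormedModule) (F := eventually) _ l m H1 H2).
Qed.

Lemma is_Cseries_scal (c : C) (a : nat -> C) l :
  is_Cseries a l -> is_Cseries (fun n => c * a n) (c * l).
Proof. exact (is_series_scal (K := C_AbsRing) (V := C_NormedModule) c a l). Qed.

Lemma is_Cseries_plus (a b : nat -> C) l m :
  is_Cseries a l -> is_Cseries b m -> is_Cseries (fun n => a n + b n) (l + m).
Proof. exact (is_series_plus (K := C_AbsRing) (V := C_NormedModule) a b l m). Qed.

Lemma is_Cseries_shift (a : nat -> C) l :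
  a 0%nat = 0 -> is_Cseries (fun n => a (S n)) l -> is_Cseries a l.
Proof.
intros H0 H; apply (is_series_decr_1 (K := C_AbsRing) (V := C_NormedModule)).
replace (plus (l : C_NormedModule) (opp (a 0%nat : C_NormedModule))) with l; [exact H|].
unfold plus, opp; simpl; rewrite H0; match goal with |- @eq _ ?a ?b => change (@eq C a b) end; ring.
Qed.

Lemma is_Cseries_unshift (a : nat -> C) l :
  a 0%nat = 0 -> is_Cseries a l -> is_Cseries (fun n => a (S n)) l.
Proof.
intros H0 H; apply (is_series_incr_1 (K := C_AbsRing) (V := C_NormedModule)).
replace (plus (l : C_NormedModule) (a 0%nat : C_NormedModule)) with l; [exact H|].
unfold plus; simpl; rewrite H0; match goal with |- @eq _ ?a ?b => change (@eq C a b) end; ring.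
Qed.

Lemma ex_Cseries_abs (a : nat -> C) (b : nat -> R) :
  (forall n, (Cmod (a n) <= b n)%R) -> ex_series b -> exists l : C, is_Cseries a l.
Proof. exact (ex_series_le (K := C_AbsRing) (V := C_CompleteNormedModule) a b). Qed.

Lemma ex_series_le_nonneg (a b : nat -> R) :
  (forall n, (0 <= a n <= b n)%R) -> ex_series b -> ex_series a.
Proof.
intros H; apply (ex_series_le (K := R_AbsRing) (V := R_CompleteNormedModule)).
intros n; unfold norm; simpl; unfold abs; simpl; rewrite Rabs_pos_eq; apply H.
Qed.

Lemma Cmod_sum_n_le (a : nat -> C) (b : nat -> R) n :
  (forall k, (k <= n)%nat -> (Cmod (a k) <= b k)%R) -> (Cmod (Csum a n) <= sum_n b n)%R.
Proof.
induction n as [|n IH]; intros H; [rewrite !sum_O; apply H; lia|].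
rewrite !sum_Sn; eapply Rle_trans; [apply Cmod_triangle|].
apply Rplus_le_compat; [apply IH; intros; apply H; lia|apply H; lia].
Qed.

Lemma Cmod_sum_n_diff_le (a : nat -> C) (b : nat -> R) n k :
  (forall k, (Cmod (a k) <= b k)%R) ->
  (Cmod (Csum a (n + k) - Csum a n) <= sum_n b (n + k) - sum_n b n)%R.
Proof.
intros H; induction k as [|k IH].
- rewrite Nat.add_0_r; replace (Csum a n - Csum a n) with (RtoC 0) by ring; rewrite Cmod_0; lra.
- rewrite Nat.add_succ_r, !sum_Sn.
  replace (plus (Csum a (n + k)) (a (S (n + k))) - Csum a n)
    with ((Csum a (n + k) - Csum a n) + a (S (n + k))).
  2:{ unfold plus; simpl; match goal with |- @eq _ ?a ?b => change (@eq C a b) end; ring. }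
  eapply Rle_trans; [apply Cmod_triangle|].
  generalize (H (S (n + k))); unfold plus; simpl; lra.
Qed.

Lemma limC_Cmod (u : nat -> C) l :
  limC u eventually l -> is_lim_seq (fun n => Cmod (u n)) (Cmod l).
Proof.
intros H; eapply filterlim_comp; [exact H|].
exact (filterlim_norm (K := C_AbsRing) (V := C_NormedModule) l).
Qed.

(** The bound depends on [b] alone; this is what makes the expansion of the integrand uniform in
    zeta. *)
Lemma Cseries_tail_le (a : nat -> C) (b : nat -> R) l m n :
  (forall k, (Cmod (a k) <= b k)%R) -> is_Cseries a l -> is_series b m ->
  (Cmod (l - Csum a n) <= m - sum_n b n)%R.
Proof.
intros H Ha Hb.
apply (is_lim_seq_le_loc (fun k => Cmod (Csum a k + - Csum a n)) (fun k => sum_n b k - sum_n b n)%R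
  (Cmod (l - Csum a n)) (m - sum_n b n)%R).
- exists n; intros k Hk; replace k with (n + (k - n))%nat by lia.
  now apply Cmod_sum_n_diff_le.
- apply limC_Cmod; apply limC_plus; [typeclasses eauto|exact Ha|solve_limC].
- apply (is_lim_seq_minus' (sum_n b) (fun _ => sum_n b n)); [exact Hb|apply is_lim_seq_const].
Qed.

Lemma Cseries_le (a : nat -> C) (b : nat -> R) l m :
  (forall k, (Cmod (a k) <= b k)%R) -> is_Cseries a l -> is_series b m -> (Cmod l <= m)%R.
Proof.
intros H Ha Hb.
apply (is_lim_seq_le (fun k => Cmod (Csum a k)) (sum_n b) (Cmod l) m).
- intros n; apply Cmod_sum_n_le; auto.
- now apply limC_Cmod.
- exact Hb.
Qed.

Lemma Rabs_Re_le z : (Rabs (Re z) <= Cmod z)%R.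
Proof. eapply Rle_trans; [apply Rmax_l|apply Rmax_Cmod]. Qed.

Lemma Rabs_Im_le z : (Rabs (Im z) <= Cmod z)%R.
Proof. eapply Rle_trans; [apply Rmax_r|apply Rmax_Cmod]. Qed.

(** Four real Cauchy products, one for each pair of components, whose absolute convergence is
    inherited from the moduli. *)
Lemma is_Cseries_mult (a b : nat -> C) la lb :
  is_Cseries a la -> is_Cseries b lb ->
  ex_series (fun n => Cmod (a n)) -> ex_series (fun n => Cmod (b n)) ->
  is_Cseries (fun n => Csum (fun k => a k * b (n - k)%nat) n) (la * lb).
Proof.
rewrite !is_Cseries_iff; intros [A1 A2] [B1 B2] HA HB.
assert (X : forall f : C -> R, (forall z, (Rabs (f z) <= Cmod z)%R) -> forall a,
  ex_series (fun n => Cmod (a n)) -> ex_series (fun n => Rabs (f (a n)))).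
{ intros f Hf u; apply ex_series_le_nonneg; intros n; split; [apply Rabs_pos|apply Hf]. }
assert (A3 := X Re Rabs_Re_le a HA); assert (A4 := X Im Rabs_Im_le a HA).
assert (B3 := X Re Rabs_Re_le b HB); assert (B4 := X Im Rabs_Im_le b HB).
split.
- eapply is_series_ext; [|exact (is_series_minus _ _ _ _
    (is_series_mult _ _ _ _ A1 B1 A3 B3) (is_series_mult _ _ _ _ A2 B2 A4 B4))].
  intros n; rewrite Re_sum_n, sum_n_Reals.
  change (sum_f_R0 (fun k => Re (a k) * Re (b (n - k)%nat))%R n
    - sum_f_R0 (fun k => Im (a k) * Im (b (n - k)%nat))%R n
    = sum_f_R0 (fun k => Re (a k * b (n - k)%nat)) n)%R.
  rewrite <- minus_sum; apply sum_eq; intros k _; reflexivity.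
- eapply is_series_ext; [|exact (is_series_plus _ _ _ _
    (is_series_mult _ _ _ _ A1 B2 A3 B4) (is_series_mult _ _ _ _ A2 B1 A4 B3))].
  intros n; rewrite Im_sum_n, sum_n_Reals.
  change (sum_f_R0 (fun k => Re (a k) * Im (b (n - k)%nat))%R n
    + sum_f_R0 (fun k => Im (a k) * Re (b (n - k)%nat))%R n
    = sum_f_R0 (fun k => Im (a k * b (n - k)%nat)) n)%R.
  rewrite <- plus_sum; apply sum_eq; intros k _; reflexivity.
Qed.

(** Convergence at 2r bounds the partial sums by some M, hence the terms by 2M, and at radius r the
    terms are then at most 2M / 2^n. *)
Lemma ex_series_Cmod_coef (e : nat -> C) r :
  (forall z, exists l : C, is_Cseries (fun n => e n * z ^ n) l) -> (0 <= r)%R ->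
  ex_series (fun n => Cmod (e n) * r ^ n)%R.
Proof.
intros H Hr; destruct (H (2 * r)%R) as [l Hl].
destruct (filterlim_bounded (K := C_AbsRing) (V := C_NormedModule) _ (ex_intro _ l Hl)) as [M HM].
set (u := fun n => e n * (2 * r)%R ^ n) in *.
assert (HM' : forall n, (Cmod (Csum u n) <= M)%R) by exact HM.
assert (B : forall n, (Cmod (u n) <= 2 * M)%R).
{ intros [|n].
  - generalize (HM' 0%nat) (Cmod_ge_0 (u 0%nat)); rewrite sum_O; lra.
  - replace (u (S n)) with (Csum u (S n) - Csum u n).
    2:{ rewrite sum_Sn; unfold plus; simpl; ring. }
    eapply Rle_trans; [apply Cmod_triangle|]; rewrite Cmod_opp.
    generalize (HM' n) (HM' (S n)); lra. }
apply ex_series_le_nonneg with (b := fun n => (2 * M * (/ 2) ^ n)%R).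
- intros n; split; [apply Rmult_le_pos; [apply Cmod_ge_0|now apply pow_le]|].
  specialize (B n); unfold u in B; rewrite Cmod_mult, <- RtoC_pow, Cmod_R, Rabs_pos_eq, Rpow_mult_distr in B.
  2:{ apply pow_le; lra. }
  assert (P2 : (0 < 2 ^ n)%R) by (apply pow_lt; lra).
  rewrite pow_inv; apply Rmult_le_reg_r with (2 ^ n)%R; [exact P2|].
  replace (2 * M * / 2 ^ n * 2 ^ n)%R with (2 * M)%R by (field; lra); lra.
- apply (ex_series_scal (K := R_AbsRing) (V := R_NormedModule) (2 * M)%R).
  apply ex_series_geom; rewrite Rabs_pos_eq; lra.
Qed.

Lemma INR_S_le_pow2 n : (INR (S n) <= 2 ^ n)%R.
Proof.
induction n as [|n IH]; [simpl; lra|].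
rewrite S_INR; simpl pow; assert (1 <= 2 ^ n)%R by (apply pow_R1_Rle; lra); lra.
Qed.

(** Since n + 1 <= 2^n, the weight (n + 1)^k is paid for by enlarging the radius to 2^k r. *)
Lemma ex_series_Cmod_coef_weight (e : nat -> C) r k :
  (forall z, exists l : C, is_Cseries (fun n => e n * z ^ n) l) -> (0 <= r)%R ->
  ex_series (fun n => INR (S n) ^ k * (Cmod (e n) * r ^ n))%R.
Proof.
intros H Hr.
apply ex_series_le_nonneg with (b := fun n => (Cmod (e n) * (2 ^ k * r) ^ n)%R).
- intros n.
  assert (P1 : (0 <= INR (S n) ^ k)%R) by apply pow_le, pos_INR.
  assert (P2 : (0 <= Cmod (e n) * r ^ n)%R) by (apply Rmult_le_pos; [apply Cmod_ge_0|now apply pow_le]).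
  split; [now apply Rmult_le_pos|].
  rewrite Rpow_mult_distr, <- pow_mult, Nat.mul_comm, pow_mult.
  replace (Cmod (e n) * ((2 ^ n) ^ k * r ^ n))%R with ((2 ^ n) ^ k * (Cmod (e n) * r ^ n))%R by ring.
  apply Rmult_le_compat_r; [exact P2|].
  apply pow_incr; split; [apply pos_INR|apply INR_S_le_pow2].
- apply ex_series_Cmod_coef; [exact H|].
  apply Rmult_le_pos; [apply pow_le; lra|exact Hr].
Qed.

(** Crude bounds suffice for entire series: [1 <= rho] allows the exponent n in place of n - 1 or n
    - 2, so that the induction closes. *)
Lemma Cpow_taylor1_bound (z h : C) rho n :
  (1 <= rho)%R -> (Cmod z <= rho)%R -> (Cmod (z + h) <= rho)%R ->
  (Cmod ((z + h) ^ n - z ^ n) <= INR n * Cmod h * rho ^ n)%R /\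
  (Cmod ((z + h) ^ n - z ^ n - h * (INR n * z ^ (n - 1)))
    <= INR n ^ 2 * Cmod h ^ 2 * rho ^ n)%R.
Proof.
intros H1 Hz Hzh; assert (Hh := Cmod_ge_0 h).
induction n as [|n [IH1 IH2]].
- simpl; split.
  + replace (1 - 1) with (RtoC 0) by ring; rewrite Cmod_0; lra.
  + replace (1 - 1 - h * (0%R * 1)) with (RtoC 0) by ring; rewrite Cmod_0; lra.
- assert (P : (0 <= rho ^ n)%R) by (apply pow_le; lra).
  assert (Hn := pos_INR n); rewrite S_INR; split.
  + replace ((z + h) ^ S n - z ^ S n) with ((z + h) * ((z + h) ^ n - z ^ n) + h * z ^ n)
      by (rewrite !Cpow_S; ring).
    eapply Rle_trans; [apply Cmod_triangle|]; rewrite !Cmod_mult, Cmod_pow.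
    assert (Cmod z ^ n <= rho ^ n)%R by (apply pow_incr; split; [apply Cmod_ge_0|exact Hz]).
    replace ((INR n + 1) * Cmod h * rho ^ S n)%R
      with (rho * (INR n * Cmod h * rho ^ n) + rho * (Cmod h * rho ^ n))%R by (simpl; ring).
    apply Rplus_le_compat.
    * apply Rmult_le_compat; auto using Cmod_ge_0.
    * assert (Cmod h * Cmod z ^ n <= Cmod h * rho ^ n)%R by now apply Rmult_le_compat_l.
      assert (0 <= Cmod h * rho ^ n)%R by now apply Rmult_le_pos.
      nra.
  + replace ((z + h) ^ S n - z ^ S n - h * ((INR n + 1)%R * z ^ (S n - 1)))
      with (z * ((z + h) ^ n - z ^ n - h * (INR n * z ^ (n - 1))) + h * ((z + h) ^ n - z ^ n)).
    2:{ rewrite RtoC_plus; destruct n as [|n]; [simpl; ring|].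
        replace (S (S n) - 1)%nat with (S n) by lia; replace (S n - 1)%nat with n by lia.
        rewrite !Cpow_S; ring. }
    eapply Rle_trans; [apply Cmod_triangle|]; rewrite !Cmod_mult.
    assert (A : (Cmod z * Cmod ((z + h) ^ n - z ^ n - h * (INR n * z ^ (n - 1)))
      <= rho * (INR n ^ 2 * Cmod h ^ 2 * rho ^ n))%R)
      by (apply Rmult_le_compat; auto using Cmod_ge_0).
    assert (B : (Cmod h * Cmod ((z + h) ^ n - z ^ n) <= Cmod h * (INR n * Cmod h * rho ^ n))%R)
      by now apply Rmult_le_compat_l.
    assert (D : (0 <= Cmod h ^ 2 * rho ^ n)%R) by (apply Rmult_le_pos; [apply pow2_ge_0|exact P]).
    replace ((INR n + 1) ^ 2 * Cmod h ^ 2 * rho ^ S n)%R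
      with (rho * (INR n ^ 2 * Cmod h ^ 2 * rho ^ n) + (2 * INR n + 1) * rho * (Cmod h ^ 2 * rho ^ n))%R
      by (simpl; ring).
    replace (Cmod h * (INR n * Cmod h * rho ^ n))%R with (INR n * (Cmod h ^ 2 * rho ^ n))%R in B by ring.
    assert (INR n <= (2 * INR n + 1) * rho)%R by nra.
    assert (INR n * (Cmod h ^ 2 * rho ^ n) <= (2 * INR n + 1) * rho * (Cmod h ^ 2 * rho ^ n))%R
      by now apply Rmult_le_compat_r.
    lra.
Qed.

(** The conclusion is a quadratic remainder rather than a derivative because it serves twice: for
    the complex derivative inside [Lop], and for real derivatives along the line t w in the study of
    [Cexp]. [M] is the sum of (n + 1)^2 |e_n| (|z| + 1)^n. *)
Lemma Cpower_series_taylor1 (e : nat -> C) (f : C -> C) :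
  (forall z, is_Cseries (fun n => e n * z ^ n) (f z)) ->
  exists f1 : C -> C,
    (forall z, is_Cseries (fun n => e n * (INR n * z ^ (n - 1))) (f1 z)) /\
    (forall z : C, exists M, (0 <= M)%R /\ forall h, (Cmod h <= 1)%R ->
      (Cmod (f (z + h)%C - f z - h * f1 z) <= M * Cmod h ^ 2)%R).
Proof.
intros Hf.
assert (He : forall z, exists l : C, is_Cseries (fun n => e n * z ^ n) l) by (intros z; now exists (f z)).
assert (H1 : forall z, exists l : C, is_Cseries (fun n => e n * (INR n * z ^ (n - 1))) l).
{ intros z; set (rho := (Cmod z + 1)%R).
  assert (Hr : (1 <= rho)%R) by (unfold rho; generalize (Cmod_ge_0 z); lra).
  eapply ex_Cseries_abs; [|apply (@ex_series_Cmod_coef_weight e rho 1 He); lra].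
  intros n; rewrite !Cmod_mult, Cmod_pow, Cmod_R, Rabs_pos_eq by apply pos_INR.
  replace (INR (S n) ^ 1 * (Cmod (e n) * rho ^ n))%R with (Cmod (e n) * (INR (S n) * rho ^ n))%R by ring.
  apply Rmult_le_compat_l; [apply Cmod_ge_0|].
  apply Rmult_le_compat; [apply pos_INR|apply pow_le, Cmod_ge_0|apply le_INR; lia|].
  apply Rle_trans with (rho ^ (n - 1))%R.
  - apply pow_incr; split; [apply Cmod_ge_0|unfold rho; lra].
  - apply Rle_pow; [exact Hr|lia]. }
set (f1 := fun z => (Series (fun n => Re (e n * (INR n * z ^ (n - 1)))),
                     Series (fun n => Im (e n * (INR n * z ^ (n - 1))))) : C).
assert (Hf1 : forall z, is_Cseries (fun n => e n * (INR n * z ^ (n - 1))) (f1 z)).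
{ intros z; destruct (H1 z) as [l Hl].
  replace (f1 z) with l; [exact Hl|].
  apply is_Cseries_iff in Hl; destruct Hl as [Hl1 Hl2].
  apply C_eq; symmetry; now apply is_series_unique. }
exists f1; split; [exact Hf1|].
intros z; set (rho := (Cmod z + 1)%R).
assert (Hr : (1 <= rho)%R) by (unfold rho; generalize (Cmod_ge_0 z); lra).
destruct (@ex_series_Cmod_coef_weight e rho 2 He) as [M HM]; [lra|].
exists M; split.
{ rewrite <- (is_series_unique _ _ HM), <- (Rmult_0_l (Series (fun _ => 0%R))).
  rewrite <- Series_scal_l; apply Series_le; [|eexists; exact HM].
  intros n; split; [lra|]; rewrite Rmult_0_l.
  apply Rmult_le_pos; [apply pow_le, pos_INR|apply Rmult_le_pos; [apply Cmod_ge_0|apply pow_le; lra]]. }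
intros h Hh; rewrite Rmult_comm.
apply (Cseries_le (a := fun n => e n * ((z + h) ^ n - z ^ n - h * (INR n * z ^ (n - 1))))
  (b := fun n => (Cmod h ^ 2 * (INR (S n) ^ 2 * (Cmod (e n) * rho ^ n)))%R)).
- intros n; rewrite Cmod_mult.
  destruct (@Cpow_taylor1_bound z h rho n Hr) as [_ B].
  { unfold rho; lra. }
  { eapply Rle_trans; [apply Cmod_triangle|unfold rho; lra]. }
  apply Rle_trans with (Cmod (e n) * (INR n ^ 2 * Cmod h ^ 2 * rho ^ n))%R.
  { apply Rmult_le_compat_l; [apply Cmod_ge_0|exact B]. }
  replace (Cmod h ^ 2 * (INR (S n) ^ 2 * (Cmod (e n) * rho ^ n)))%R
    with (INR (S n) ^ 2 * (Cmod (e n) * (Cmod h ^ 2 * rho ^ n)))%R by ring.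
  replace (Cmod (e n) * (INR n ^ 2 * Cmod h ^ 2 * rho ^ n))%R
    with (INR n ^ 2 * (Cmod (e n) * (Cmod h ^ 2 * rho ^ n)))%R by ring.
  apply Rmult_le_compat_r.
  + apply Rmult_le_pos; [apply Cmod_ge_0|apply Rmult_le_pos; [apply pow2_ge_0|apply pow_le; lra]].
  + apply pow_incr; split; [apply pos_INR|apply le_INR; lia].
- replace (f (z + h) - f z - h * f1 z) with (f (z + h) + -(1) * f z + - h * f1 z) by ring.
  eapply is_Cseries_ext; [|apply is_Cseries_plus;
    [apply is_Cseries_plus; [exact (Hf (z + h))|apply is_Cseries_scal with (c := -(1)); exact (Hf z)]
    |apply is_Cseries_scal with (c := - h); exact (Hf1 z)]].
  intros n; cbv beta; ring.
- apply (is_series_scal (K := R_AbsRing) (V := R_NormedModule) (Cmod h ^ 2)%R _ _ HM).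
Qed.

Lemma is_derive_quadratic {K : AbsRing} {V : NormedModule K} (f : K -> V) x l M :
  (0 <= M)%R ->
  locally x (fun y => norm (minus (minus (f y) (f x)) (scal (minus y x) l))
                      <= M * norm (minus y x) ^ 2)%R ->
  is_derive f x l.
Proof.
intros HM H; split; [apply is_linear_scal_l|].
intros y Hy; rewrite <- (is_filter_lim_locally_unique _ _ Hy); intros eps.
assert (Hd : (0 < eps / (M + 1))%R) by (apply Rdiv_lt_0_compat; [apply cond_pos|lra]).
assert (L := locally_le_locally_norm _ _ (locally_norm_ball_norm x (mkposreal _ Hd))).
generalize (filter_and _ _ H L); apply filter_imp; intros t [H1 H2].
eapply Rle_trans; [exact H1|].
unfold ball_norm in H2; simpl in H2; assert (N := norm_ge_0 (minus t x)).
replace (M * norm (minus t x) ^ 2)%R with (M * norm (minus t x) * norm (minus t x))%R by ring.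
apply Rmult_le_compat_r; [exact N|].
apply Rle_trans with (M * (eps / (M + 1)))%R.
- apply Rmult_le_compat_l; [exact HM|now left].
- apply Rmult_le_reg_r with (M + 1)%R; [lra|].
  replace (M * (eps / (M + 1)) * (M + 1))%R with (M * eps)%R by (field; lra).
  generalize (cond_pos eps); nra.
Qed.

Lemma Cpower_series_is_derive (f f1 : C -> C) (z : C) M :
  (0 <= M)%R ->
  (forall h, (Cmod h <= 1)%R -> (Cmod (f (z + h)%C - f z - h * f1 z) <= M * Cmod h ^ 2)%R) ->
  is_derive (K := C_AbsRing) (V := C_NormedModule) f z (f1 z).
Proof.
intros HM H; apply is_derive_quadratic with M; [exact HM|].
generalize (locally_le_locally_norm _ _ (locally_norm_ball_norm (z : AbsRing_NormedModule C_AbsRing) (mkposreal 1 Rlt_0_1))).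
apply filter_imp; intros y Hy.
assert (Hy' : (Cmod (y - z) <= 1)%R) by (left; exact Hy).
generalize (H (y - z) Hy'); replace (z + (y - z)) with y
  by (apply C_eq; Rring).
intros H'; exact H'.
Qed.

Lemma Cpower_series_is_derC (f f1 : C -> C) (w : C) (t : R) M :
  (0 <= M)%R ->
  (forall h, (Cmod h <= 1)%R -> (Cmod (f (t * w + h)%C - f (t * w)%C - h * f1 (t * w)%C) <= M * Cmod h ^ 2)%R) ->
  is_derC (fun t : R => f (t * w)) t (w * f1 (t * w)).
Proof.
intros HM H; apply is_derive_quadratic with (M * Cmod w ^ 2)%R.
{ apply Rmult_le_pos; [exact HM|apply pow2_ge_0]. }
(* Within this radius |(y - t) w| < 1, the range in which the remainder bound holds. *)
assert (Hd : (0 < / (Cmod w + 1))%R) by (apply Rinv_0_lt_compat; generalize (Cmod_ge_0 w); lra).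
exists (mkposreal _ Hd); intros y Hy.
assert (Hy' : (Rabs (y - t) < / (Cmod w + 1))%R) by exact Hy.
assert (E : Cmod ((y - t)%R * w) = (Rabs (y - t) * Cmod w)%R) by now rewrite Cmod_mult, Cmod_R.
assert (Hh : (Cmod ((y - t)%R * w) <= 1)%R).
{ rewrite E; assert (Hw := Cmod_ge_0 w).
  replace 1%R with (/ (Cmod w + 1) * (Cmod w + 1))%R by (field; lra).
  apply Rmult_le_compat; [apply Rabs_pos|exact Hw|now left|lra]. }
generalize (H _ Hh); rewrite E.
replace (t * w + (y - t)%R * w) with (y * w) by (rewrite RtoC_minus; ring).
intros H'; rewrite norm_C_R.
replace (norm (minus y t)) with (Rabs (y - t)) by reflexivity.
replace (minus (minus (f (y * w) : C_R_NormedModule) (f (t * w))) (scal (minus y t) (w * f1 (t * w) : C_R_NormedModule)))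
  with (f (y * w) - f (t * w) - (y - t)%R * w * f1 (t * w)) by (apply C_eq; Rring).
eapply Rle_trans; [exact H'|right; ring].
Qed.

(** [Cexp] is given by real exp, cos and sin, so the series is identified through its differential
    equation: its sum [g] satisfies g' = g and g(0) = 1, hence g(tw) [Cexp] (-tw) is constant for t
    in [0, 1]. *)
Lemma Cexp_series (w : C) : is_Cseries (fun n => / INR (fact n) * w ^ n) (Cexp w).
Proof.
assert (He : forall z : C, exists l : C, is_Cseries (fun n => / INR (fact n) * z ^ n) l).
{ intros z; eapply ex_Cseries_abs; [|eexists; exact (proj1 (is_pseries_R _ _ _) (is_exp_Reals (Cmod z)))].
  intros n; rewrite Cmod_mult, Cmod_pow, Cmod_inv by apply INR_fact_neq_0_C.
  rewrite Cmod_R, Rabs_pos_eq by apply pos_INR.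
  apply Rle_refl. }
set (g := fun z : C => (Series (fun n => Re (/ INR (fact n) * z ^ n)),
                     Series (fun n => Im (/ INR (fact n) * z ^ n))) : C).
assert (Hg : forall z, is_Cseries (fun n => / INR (fact n) * z ^ n) (g z)).
{ intros z; destruct (He z) as [l Hl].
  replace (g z) with l; [exact Hl|].
  apply is_Cseries_iff in Hl; destruct Hl as [Hl1 Hl2].
  apply C_eq; symmetry; now apply is_series_unique. }
destruct (Cpower_series_taylor1 _ _ Hg) as [g1 [Hg1 HT]].
assert (E : forall z, g1 z = g z).
{ intros z; apply (is_Cseries_unique (a := fun n => / INR (fact n) * z ^ n)); [|apply Hg].
  eapply is_Cseries_ext; [|apply is_Cseries_unshift; [|exact (Hg1 z)]; simpl; ring].
  intros n; cbv beta; replace (S n - 1)%nat with n by lia.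
  rewrite fact_simpl, mult_INR, RtoC_mult; field; split; [apply INR_fact_neq_0_C|].
  intros h; apply RtoC_inj in h; rewrite S_INR in h; generalize (pos_INR n); lra. }
assert (G0 : g 0 = 1).
{ apply (is_Cseries_unique (a := fun n => / INR (fact n) * 0 ^ n)); [apply Hg|].
  replace (RtoC 1) with (Csum (fun n => / INR (fact n) * 0 ^ n) 0).
  2:{ rewrite sum_O; simpl; field. }
  eapply filterlim_ext; [|apply filterlim_const]; intros n; cbv beta.
  induction n as [|n IH]; [reflexivity|].
  rewrite sum_Sn, <- IH, Cpow_S.
  match goal with |- @eq _ ?a ?b => refine (_ : @eq C a b) end.
  rewrite Cmult_0_l, Cmult_0_r; symmetry; apply Cplus_0_r. }
assert (D : forall t, is_derC (fun t : R => g (t * w) * Cexp (t * - w)) t 0).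
{ intros t; destruct (HT (t * w)) as [M [HM HT']]; eapply is_derC_eq.
  - apply is_derC_mult; [exact (Cpower_series_is_derC _ _ _ _ HM HT')|].
    apply is_derC_Cexp, is_derC_mult; [|apply is_derC_const].
    apply is_derC_RtoC; exact (is_derive_id (K := R_AbsRing) t).
  - rewrite E; unfold one; simpl; match goal with |- @eq _ ?a ?b => change (@eq C a b) end; ring. }
assert (F := eq_is_derive (V := C_R_NormedModule) (fun t : R => g (t * w) * Cexp (t * - w)) 0 1
  (fun t _ => D t) Rlt_0_1); cbv beta in F.
replace (Cexp w) with (g w); [apply Hg|].
rewrite !Cmult_0_l, G0, Cexp_0, !Cmult_1_l, Cexp_opp in F.
transitivity (g w * / Cexp w * Cexp w); [field; apply Cexp_neq_0|].
rewrite <- F; ring.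
Qed.

(** Restricted to real arguments, the components of f are real power series of positive radius,
    whose coefficients are read off from the iterated derivatives at 0. *)
Lemma Cpower_series_inj (a b : nat -> C) (f : C -> C) :
  (forall z, is_Cseries (fun n => a n * z ^ n) (f z)) ->
  (forall z, is_Cseries (fun n => b n * z ^ n) (f z)) ->
  forall n, a n = b n.
Proof.
assert (X : forall (p q : nat -> R) (g : R -> R),
  (forall r, is_series (fun n => p n * r ^ n)%R (g r)) ->
  (forall r, is_series (fun n => q n * r ^ n)%R (g r)) -> forall n, p n = q n).
{ intros p q g Hp Hq n.
  assert (Y : forall p : nat -> R, (forall r, is_series (fun n => p n * r ^ n)%R (g r)) ->
    Derive_n g n 0 = (p n * INR (fact n))%R).
  { intros u Hu; rewrite <- Derive_n_coef.
    - apply Derive_n_ext; intros t; symmetry; unfold PSeries; now apply is_series_unique.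
    - apply Rbar_not_le_lt; intros h.
      apply (@CV_disk_outside u 1).
      + eapply Rbar_le_lt_trans; [exact h|]; rewrite Rabs_R1; simpl; lra.
      + apply ex_series_lim_0; eexists; apply Hu. }
  assert (Z := Y p Hp); rewrite (Y q Hq) in Z.
  symmetry; apply Rmult_eq_reg_r in Z; [exact Z|apply INR_fact_neq_0]. }
intros Ha Hb n; apply C_eq.
- apply (X (fun n => Re (a n)) (fun n => Re (b n)) (fun r => Re (f r))); intros r.
  + eapply is_series_ext; [|apply (proj1 (proj1 (is_Cseries_iff _ _) (Ha r)))].
    intros k; cbv beta; rewrite <- RtoC_pow; Rring.
  + eapply is_series_ext; [|apply (proj1 (proj1 (is_Cseries_iff _ _) (Hb r)))].
    intros k; cbv beta; rewrite <- RtoC_pow; Rring.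
- apply (X (fun n => Im (a n)) (fun n => Im (b n)) (fun r => Im (f r))); intros r.
  + eapply is_series_ext; [|apply (proj2 (proj1 (is_Cseries_iff _ _) (Ha r)))].
    intros k; cbv beta; rewrite <- RtoC_pow; Rring.
  + eapply is_series_ext; [|apply (proj2 (proj1 (is_Cseries_iff _ _) (Hb r)))].
    intros k; cbv beta; rewrite <- RtoC_pow; Rring.
Qed.

(** * The operator *)

(** [Rfun] is controlled only on [0, 1]; composing with this retraction gives integrands that are
    continuous, and series that converge uniformly, on the whole line without changing the
    integral. *)
Definition clamp01 (t : R) : R := Rmax 0 (Rmin t 1).

Lemma clamp01_bound t : (0 <= clamp01 t <= 1)%R.
Proof.
unfold clamp01; split; [apply Rmax_l|].
apply Rmax_lub; [lra|apply Rmin_r].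
Qed.

Lemma clamp01_id t : (0 <= t <= 1)%R -> clamp01 t = t.
Proof. intros H; unfold clamp01; rewrite Rmin_left, Rmax_right; lra. Qed.

Lemma clamp01_continuous t : continuous clamp01 t.
Proof.
apply filterlim_locally; intros e; exists e; intros y.
unfold ball; simpl; unfold AbsRing_ball, abs, minus, plus, opp; simpl; intros H.
eapply Rle_lt_trans; [|exact H].
unfold clamp01, Rmax, Rmin.
repeat destruct Rle_dec; unfold Rabs; repeat destruct Rcase_abs; lra.
Qed.

Lemma contC_Csum (f : nat -> R -> C) n t :
  (forall k, contC (f k) t) -> contC (fun t => Csum (fun k => f k t) n) t.
Proof.
intros H; induction n as [|n IH].
- apply filterlim_ext with (f 0%nat); [intros y; now rewrite sum_O|].
  rewrite sum_O; apply H.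
- apply filterlim_ext with (fun t => Csum (fun k => f k t) n + f (S n) t);
    [intros y; now rewrite sum_Sn|].
  rewrite sum_Sn; apply limC_plus; [typeclasses eauto|exact IH|apply H].
Qed.

Lemma contC_pow (f : R -> C) n t : contC f t -> contC (fun t => f t ^ n) t.
Proof. intros H; apply limC_pow; [typeclasses eauto|exact H]. Qed.

Lemma contC_mult (f g : R -> C) t : contC f t -> contC g t -> contC (fun t => f t * g t) t.
Proof. intros Hf Hg; apply limC_mult; [typeclasses eauto|exact Hf|exact Hg]. Qed.

Lemma contC_plus (f g : R -> C) t : contC f t -> contC g t -> contC (fun t => f t + g t) t.
Proof. intros Hf Hg; apply limC_plus; [typeclasses eauto|exact Hf|exact Hg]. Qed.

Lemma contC_const (c : C) t : contC (fun _ => c) t.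
Proof. apply filterlim_const. Qed.

Lemma newton_zero D Fa Fb {FFa : Filter Fa} {FFb : Filter Fb} (f : R -> C) :
  (forall t, D t -> f t = 0) -> newton D Fa Fb f 0.
Proof.
intros H; exists (fun _ => RtoC 0), (RtoC 0), (RtoC 0); split; [|split; [|split]].
- intros t Ht; rewrite H by exact Ht; apply is_derC_const.
- apply filterlim_const.
- apply filterlim_const.
- ring.
Qed.

Lemma Rfun_clamp_contC (x nu : C) t :
  ~ (Im x = 0%R /\ (Re x <= 0)%R) -> (Re nu < 0)%R ->
  contC (fun t => Rfun x nu (clamp01 t)) t.
Proof.
intros Hx Hnu.
apply (filterlim_ext (fun t => eulerian x (- nu) (nu - 1) (clamp01 t))).
{ intros y; symmetry; apply Rfun_eulerian; [exact Hx|exact Hnu|apply clamp01_bound]. }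
rewrite Rfun_eulerian by (assumption || apply clamp01_bound).
apply (continuous_comp (U := R_UniformSpace) (V := R_UniformSpace) (W := C_UniformSpace) clamp01).
- apply clamp01_continuous.
- apply eulerian_contC; [exact Hx|unfold Re in *; simpl; lra|apply clamp01_bound].
Qed.

Lemma Rfun_bounded (x nu : C) :
  ~ (Im x = 0%R /\ (Re x <= 0)%R) -> (Re nu < 0)%R ->
  exists rho, (0 <= rho)%R /\ forall z, (0 <= z <= 1)%R -> (Cmod (Rfun x nu z) <= rho)%R.
Proof.
intros Hx Hnu.
destruct (continuity_ab_maj (fun t => Cmod (Rfun x nu (clamp01 t))) 0 1) as [t0 [H _]]; [lra| |].
- intros t _; apply continuity_pt_filterlim.
  eapply filterlim_comp; [exact (@Rfun_clamp_contC x nu t Hx Hnu)|].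
  exact (filterlim_norm (K := C_AbsRing) (V := C_NormedModule) _).
- exists (Cmod (Rfun x nu (clamp01 t0))); split; [apply Cmod_ge_0|].
  intros z Hz; rewrite <- (@clamp01_id z Hz); now apply H.
Qed.

(* Coefficient of [z^n] in the integrand of [Lop], for [f] with Taylor
   coefficients [e]. *)
Definition Lop_coef (x nu : C) (e : nat -> C) (n : nat) (zeta : R) : C :=
  Csum (fun l => e l * ((- (1)) ^ (n - l) / INR (fact (n - l))) *
    (Rfun x nu zeta ^ n *
      ((1 - INR (n - l)) * zeta ^ l - cst x nu * INR l * zeta ^ (l - 1)))) n.

Lemma newton_Lop_coef (x nu : C) (e : nat -> C) n :
  ~ (Im x = 0%R /\ (Re x <= 0)%R) -> x <> 1 -> (Re nu < 0)%R -> e 0%nat = 0 ->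
  newton1 (Lop_coef x nu e n)
    (Csum (fun l => e l * ((- (1)) ^ (n - l) / INR (fact (n - l))) * Qcoef x nu n l) n).
Proof.
intros Hx Hx1 Hnu He0; unfold Lop_coef.
apply newton_sum_n with (f := fun l (zeta : R) => e l * ((- (1)) ^ (n - l) / INR (fact (n - l))) *
    (Rfun x nu zeta ^ n *
      ((1 - INR (n - l)) * zeta ^ l - cst x nu * INR l * zeta ^ (l - 1))));
  [typeclasses eauto|typeclasses eauto|].
intros [|l] Hl.
(* The moment formula starts at l = 1; the term l = 0 disappears with [e 0]. *)
- rewrite He0, !Cmult_0_l; apply newton_zero; [typeclasses eauto|typeclasses eauto|].
  intros; apply Cmult_0_l.
- apply newton_scal; [typeclasses eauto|typeclasses eauto|].
  apply newton_moment; [exact Hx|exact Hx1|exact Hnu|lia].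
Qed.

Lemma Lop_coef_clamp_contC (x nu : C) (e : nat -> C) n t :
  ~ (Im x = 0%R /\ (Re x <= 0)%R) -> (Re nu < 0)%R ->
  contC (fun t => Lop_coef x nu e n (clamp01 t)) t.
Proof.
intros Hx Hnu; unfold Lop_coef; apply contC_Csum; intros l.
assert (Hc : contC (fun t => RtoC (clamp01 t)) t).
{ apply (limC_iff (F := locally t) (fun t => RtoC (clamp01 t)) (RtoC (clamp01 t))); split.
  - apply clamp01_continuous.
  - exact (filterlim_const (F := locally t) (0%R : R_UniformSpace)). }
apply contC_mult; [apply contC_const|].
apply contC_mult; [now apply contC_pow, Rfun_clamp_contC|].
unfold Cminus; apply contC_plus.
- apply contC_mult; [apply contC_const|now apply contC_pow].
- apply (filterlim_ext (fun t => - (cst x nu * INR l) * clamp01 t ^ (l - 1))).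
  { intros y; match goal with |- @eq _ ?a ?b => refine (_ : @eq C a b) end; ring. }
  match goal with |- filterlim _ _ (locally ?v) =>
    replace v with (- (cst x nu * INR l) * clamp01 t ^ (l - 1)) by ring end.
  apply contC_mult; [apply contC_const|now apply contC_pow].
Qed.

(** The factor 1 + w is multiplied into e^(-w) before expanding, which produces the 1 - (n - l) of
    [Lop_coef]; the factor w in front of f' restores the degree lost by differentiation, so both
    Cauchy products are graded by the power of z. *)
Lemma Lop_integrand_series (x nu : C) (f : C -> C) (e : nat -> C) (z : C) (zeta : R) :
  e 0%nat = 0 -> (forall z, is_Cseries (fun n => e n * z ^ n) (f z)) ->
  is_Cseries (fun n => z ^ n * Lop_coef x nu e n zeta)
    (((1 + z * Rfun x nu zeta) * f (zeta * Rfun x nu zeta * z)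
        - cst x nu * z * Rfun x nu zeta * C_derive f (zeta * Rfun x nu zeta * z))
       * Cexp (- (Rfun x nu zeta * z))).
Proof.
intros He0 Hf.
destruct (Cpower_series_taylor1 _ _ Hf) as [f1 [Hf1 HT]].
set (r := Rfun x nu zeta); set (y := zeta * r * z); set (w := r * z).
assert (Hd : C_derive f y = f1 y).
{ apply is_C_derive_unique; destruct (HT y) as [M [HM HM']].
  exact (Cpower_series_is_derive _ _ _ HM HM'). }
rewrite Hd.
assert (Hex := @Cexp_series (- w)).
assert (Hex1 : is_Cseries (fun n => (1 - INR n) * (/ INR (fact n) * (- w) ^ n))
  ((1 + w) * Cexp (- w))).
{ assert (S1 : is_Cseries (fun n => INR n * (/ INR (fact n) * (- w) ^ n)) (- w * Cexp (- w))).
  { apply is_Cseries_shift; [simpl; ring|].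
    eapply is_Cseries_ext; [|exact (@is_Cseries_scal (- w) _ _ Hex)].
    intros n; cbv beta; rewrite fact_simpl, mult_INR, RtoC_mult, Cpow_S.
    field; split; [apply INR_fact_neq_0_C|].
    intros h; apply RtoC_inj in h; rewrite S_INR in h; generalize (pos_INR n); lra. }
  replace ((1 + w) * Cexp (- w)) with (Cexp (- w) + -(1) * (- w * Cexp (- w))) by ring.
  eapply is_Cseries_ext; [|exact (is_Cseries_plus Hex (@is_Cseries_scal (-(1)) _ _ S1))].
  intros n; cbv beta; ring. }
assert (Aexp : forall k, ex_series (fun n => INR (S n) ^ k * (Cmod (/ INR (fact n)) * Cmod w ^ n))%R).
{ intros k; apply ex_series_Cmod_coef_weight; [|apply Cmod_ge_0].
  intros v; eexists; apply Cexp_series. }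
assert (Ae : forall k, ex_series (fun n => INR (S n) ^ k * (Cmod (e n) * Cmod y ^ n))%R).
{ intros k; apply ex_series_Cmod_coef_weight; [|apply Cmod_ge_0].
  intros v; eexists; apply Hf. }
assert (A0 : ex_series (fun n => Cmod (/ INR (fact n) * (- w) ^ n))).
{ eapply ex_series_ext; [|exact (Aexp 0%nat)].
  intros n; rewrite Cmod_mult, Cmod_pow, Cmod_opp; simpl; ring. }
assert (A1 : ex_series (fun n => Cmod ((1 - INR n) * (/ INR (fact n) * (- w) ^ n)))).
{ eapply ex_series_le_nonneg; [|exact (Aexp 1%nat)].
  intros n; split; [apply Cmod_ge_0|].
  rewrite !Cmod_mult, Cmod_pow, Cmod_opp, <- RtoC_minus, Cmod_R, pow_1.
  apply Rmult_le_compat_r; [apply Rmult_le_pos; [apply Cmod_ge_0|apply pow_le, Cmod_ge_0]|].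
  rewrite S_INR; assert (Hn := pos_INR n); apply Rabs_le; lra. }
assert (B0 : ex_series (fun n => Cmod (e n * y ^ n))).
{ eapply ex_series_ext; [|exact (Ae 0%nat)].
  intros n; rewrite Cmod_mult, Cmod_pow; simpl; ring. }
assert (B1 : ex_series (fun n => Cmod (w * (e n * (INR n * y ^ (n - 1)))))).
{ eapply ex_series_ext; [intros n; symmetry; apply Cmod_mult|].
  apply (ex_series_scal (K := R_AbsRing) (V := R_NormedModule) (Cmod w)).
  (* The radius |y| + 1 >= 1 makes the power n - 1 at most the power n. *)
  assert (Ae' : ex_series (fun n => INR (S n) ^ 1 * (Cmod (e n) * (Cmod y + 1) ^ n))%R).
  { apply ex_series_Cmod_coef_weight; [|generalize (Cmod_ge_0 y); lra].
    intros v; eexists; apply Hf. }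
  eapply ex_series_le_nonneg; [|exact Ae'].
  intros n; split; [apply Cmod_ge_0|].
  rewrite !Cmod_mult, Cmod_pow, Cmod_R, Rabs_pos_eq by apply pos_INR.
  replace (INR (S n) ^ 1 * (Cmod (e n) * (Cmod y + 1) ^ n))%R
    with (Cmod (e n) * (INR (S n) * (Cmod y + 1) ^ n))%R by ring.
  apply Rmult_le_compat_l; [apply Cmod_ge_0|].
  apply Rmult_le_compat; [apply pos_INR|apply pow_le, Cmod_ge_0|apply le_INR; lia|].
  assert (Hy := Cmod_ge_0 y); apply Rle_trans with ((Cmod y + 1) ^ (n - 1))%R.
  - apply pow_incr; lra.
  - apply Rle_pow; [lra|lia]. }
assert (P1 := is_Cseries_mult (Hf y) Hex1 B0 A1).
assert (P2 := is_Cseries_mult (@is_Cseries_scal w _ _ (Hf1 y)) Hex B1 A0).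
replace (((1 + z * r) * f y - cst x nu * z * r * f1 y) * Cexp (- w))
  with (f y * ((1 + w) * Cexp (- w)) + - cst x nu * (w * f1 y * Cexp (- w)))
  by (unfold w; ring).
eapply is_Cseries_ext; [|exact (is_Cseries_plus P1 (@is_Cseries_scal (- cst x nu) _ _ P2))].
intros n; cbv beta; unfold Lop_coef.
rewrite <- !Csum_n_scal.
match goal with |- ?s + ?t = ?v => change (plus (s : C_AbelianMonoid) t = v) end.
rewrite <- (sum_n_plus (G := C_AbelianMonoid)); apply Csum_n_ext; intros l Hl.
unfold plus; simpl.
destruct l as [|l]; [rewrite He0; ring|].
replace (S l - 1)%nat with l by lia.
replace (- w) with (- (1) * w) by ring; rewrite Cpow_mult_l.
fold r; replace (z ^ n) with (z * z ^ l * z ^ (n - S l))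
  by (rewrite <- Cpow_S, <- Cpow_add_r; f_equal; lia).
replace (r ^ n) with (r * r ^ l * r ^ (n - S l))
  by (rewrite <- Cpow_S, <- Cpow_add_r; f_equal; lia).
unfold y, w; rewrite !Cpow_S, !Cpow_mult_l.
match goal with |- @eq _ ?a ?b => refine (_ : @eq C a b) end.
field; apply INR_fact_neq_0_C.
Qed.

(** Weierstrass majorant, uniform in zeta: the Cauchy product of the series of |e_l| r^l and r^k /
    k! at r = rho |z|. The weights l + 1 and k + 1 absorb the polynomial factor, which is at most (1
    + c)(l + 1)(k + 1). *)
Lemma Lop_coef_bound (x nu : C) (f : C -> C) (e : nat -> C) (z : C) :
  ~ (Im x = 0%R /\ (Re x <= 0)%R) -> (Re nu < 0)%R ->
  (forall z, is_Cseries (fun n => e n * z ^ n) (f z)) ->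
  exists b : nat -> R, ex_series b /\
    forall n zeta, (0 <= zeta <= 1)%R -> (Cmod (z ^ n * Lop_coef x nu e n zeta) <= b n)%R.
Proof.
intros Hx Hnu Hf.
destruct (Rfun_bounded x nu Hx Hnu) as [rho [Hrho Hb]].
set (c := Cmod (cst x nu)); assert (Hc : (0 <= c)%R) by apply Cmod_ge_0.
set (r := (rho * Cmod z)%R).
assert (Hr : (0 <= r)%R) by (apply Rmult_le_pos; [exact Hrho|apply Cmod_ge_0]).
set (al := fun n => (INR (S n) ^ 1 * (Cmod (e n) * r ^ n))%R).
set (ga := fun n => (INR (S n) ^ 1 * (Cmod (/ INR (fact n)) * r ^ n))%R).
assert (Hal : ex_series al).
{ apply ex_series_Cmod_coef_weight; [|exact Hr]; intros v; eexists; apply Hf. }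
assert (Hga : ex_series ga).
{ apply ex_series_Cmod_coef_weight with (e := fun n => / INR (fact n)); [|exact Hr].
  intros v; eexists; apply Cexp_series. }
assert (Pos : forall (u : nat -> C) n, (0 <= INR (S n) ^ 1 * (Cmod (u n) * r ^ n))%R).
{ intros u n; apply Rmult_le_pos; [apply pow_le, pos_INR|].
  apply Rmult_le_pos; [apply Cmod_ge_0|now apply pow_le]. }
assert (Hal' : ex_series (fun n => Rabs (al n))).
{ eapply ex_series_ext; [|exact Hal]; intros n; symmetry; apply Rabs_pos_eq, Pos. }
assert (Hga' : ex_series (fun n => Rabs (ga n))).
{ eapply ex_series_ext; [|exact Hga]; intros n; symmetry.
  apply Rabs_pos_eq, (Pos (fun n => / INR (fact n))). }
destruct Hal as [sa Hsa]; destruct Hga as [sg Hsg].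
assert (Hm := is_series_mult _ _ _ _ Hsa Hsg Hal' Hga').
exists (fun n => ((1 + c) * sum_f_R0 (fun k => al k * ga (n - k)%nat) n)%R); split.
{ apply (ex_series_scal (K := R_AbsRing) (V := R_NormedModule) (1 + c)%R).
  eexists; exact Hm. }
intros n zeta Hz; unfold Lop_coef; rewrite <- Csum_n_scal, scal_sum, <- sum_n_Reals.
apply Cmod_sum_n_le; intros l Hl.
set (k := (n - l)%nat).
rewrite !Cmod_mult, !Cmod_pow, Cmod_div by apply INR_fact_neq_0_C.
rewrite Cmod_pow, Cmod_opp, Cmod_1, pow1.
assert (Hw : (Cmod z ^ n * Cmod (Rfun x nu zeta) ^ n <= r ^ l * r ^ k)%R).
{ rewrite <- pow_add; replace (l + k)%nat with n by (unfold k; lia).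
  unfold r; rewrite Rmult_comm, Rpow_mult_distr; apply Rmult_le_compat_r.
  - apply pow_le, Cmod_ge_0.
  - apply pow_incr; split; [apply Cmod_ge_0|now apply Hb]. }
assert (Hp : (Cmod ((1 - INR k) * zeta ^ l - cst x nu * INR l * zeta ^ (l - 1))
   <= (1 + c) * (INR (S l) * INR (S k)))%R).
{ eapply Rle_trans; [apply Cmod_triangle|].
  rewrite Cmod_opp, !Cmod_mult, !Cmod_pow, <- RtoC_minus, !Cmod_R; fold c.
  rewrite (Rabs_pos_eq zeta), (Rabs_pos_eq (INR l)) by (apply pos_INR || lra).
  assert (Z : forall j, (0 <= zeta ^ j <= 1)%R).
  { intros j; split; [apply pow_le; lra|].
    rewrite <- (pow1 j); apply pow_incr; lra. }
  destruct (Z l) as [Z1 Z2]; destruct (Z (l - 1)%nat) as [Z3 Z4].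
  rewrite !S_INR; assert (Hk := pos_INR k); assert (Hl' := pos_INR l).
  assert (Y1 : (Rabs (1 - INR k) <= INR k + 1)%R) by (apply Rabs_le; lra).
  assert (Y2 : (Rabs (1 - INR k) * zeta ^ l <= (INR k + 1) * 1)%R)
    by (apply Rmult_le_compat; auto using Rabs_pos).
  assert (Y3 : (c * INR l * zeta ^ (l - 1) <= c * INR l * 1)%R)
    by (apply Rmult_le_compat_l; [now apply Rmult_le_pos|assumption]).
  assert (0 <= INR l * INR k)%R by now apply Rmult_le_pos.
  assert (0 <= c * (INR l * INR k))%R by now apply Rmult_le_pos.
  assert (0 <= c * INR k)%R by now apply Rmult_le_pos.
  lra. }
unfold al, ga; fold k; rewrite !pow_1, Cmod_inv by apply INR_fact_neq_0_C.
unfold Rdiv; rewrite Rmult_1_l.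
set (E := Cmod (e l)); set (F := (/ Cmod (INR (fact k)))%R).
assert (HE : (0 <= E)%R) by apply Cmod_ge_0.
assert (HF : (0 <= F)%R).
{ left; apply Rinv_0_lt_compat, Cmod_gt_0, INR_fact_neq_0_C. }
set (W := (Cmod z ^ n * Cmod (Rfun x nu zeta) ^ n)%R) in *.
match goal with |- (?a <= ?b)%R =>
  replace a with (E * F * (W * Cmod ((1 - INR k) * zeta ^ l - cst x nu * INR l * zeta ^ (l - 1))))%R
    by (unfold W; ring);
  replace b with (E * F * ((r ^ l * r ^ k) * ((1 + c) * (INR (S l) * INR (S k)))))%R by ring end.
apply Rmult_le_compat_l; [now apply Rmult_le_pos|].
apply Rmult_le_compat; [|apply Cmod_ge_0|exact Hw|exact Hp].
unfold W; apply Rmult_le_pos; apply pow_le, Cmod_ge_0.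
Qed.

(** Each partial sum [FN] has an exact integral by the moment formula; uniform convergence of the
    clamped partial sums carries these values to the integral of the limit. *)
Lemma Lop_series (x nu : C) (f : C -> C) (e : nat -> C) (z : C) :
  ~ (Im x = 0%R /\ (Re x <= 0)%R) -> x <> 1 -> (Re nu < 0)%R ->
  e 0%nat = 0 -> (forall z, is_Cseries (fun n => e n * z ^ n) (f z)) ->
  is_Cseries (fun n => z ^ n *
    Csum (fun l => e l * ((- (1)) ^ (n - l) / INR (fact (n - l))) * Qcoef x nu n l) n)
    (Lop x nu f z).
Proof.
intros Hx Hx1 Hnu He0 Hf.
destruct (Lop_coef_bound x nu f e z Hx Hnu Hf) as [b [[sb Hb] Hbd]].
set (Phi := fun zeta : R => ((1 + z * Rfun x nu zeta) * f (zeta * Rfun x nu zeta * z)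
        - cst x nu * z * Rfun x nu zeta * C_derive f (zeta * Rfun x nu zeta * z))
       * Cexp (- (Rfun x nu zeta * z))).
set (h := fun n => z ^ n *
    Csum (fun l => e l * ((- (1)) ^ (n - l) / INR (fact (n - l))) * Qcoef x nu n l) n).
set (FN := fun N t => Csum (fun n => z ^ n * Lop_coef x nu e n (clamp01 t)) N).
assert (HI : forall N, is_RInt (V := C_R_CompleteNormedModule) (FN N) 0 1 (Csum h N)).
{ intros N; apply newton_RInt; [|lra|].
  - apply newton_ext with (fun t => Csum (fun n => z ^ n * Lop_coef x nu e n t) N).
    { intros t Ht; unfold FN; rewrite clamp01_id by lra; reflexivity. }
    apply newton_sum_n with (f := fun n t => z ^ n * Lop_coef x nu e n t);
      [typeclasses eauto|typeclasses eauto|].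
    intros n _; apply newton_scal; [typeclasses eauto|typeclasses eauto|].
    now apply newton_Lop_coef.
  - intros t; apply (contC_Csum (fun n t => z ^ n * Lop_coef x nu e n (clamp01 t))); intros n.
    apply contC_mult; [apply contC_const|now apply Lop_coef_clamp_contC]. }
assert (HU : filterlim (fun N => FN N : fct_UniformSpace R C_R_CompleteNormedModule) eventually
  (locally (fun t => Phi (clamp01 t)))).
{ apply filterlim_locally; intros eps.
  assert (L := proj1 (filterlim_locally (sum_n b) sb) Hb eps).
  revert L; apply filter_imp; intros N HN t.
  assert (B := @Cseries_tail_le _ b _ sb N (fun k => Hbd k (clamp01 t) (clamp01_bound t))
    (@Lop_integrand_series x nu f e z (clamp01 t) He0 Hf) Hb).
  fold (Phi (clamp01 t)) in B; fold (FN N t) in B.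
  assert (HN' : (Rabs (sum_n b N - sb) < eps)%R) by exact HN.
  apply Rabs_lt_between in HN'.
  assert (B' : (Cmod (FN N t - Phi (clamp01 t)) < eps)%R).
  { replace (FN N t - Phi (clamp01 t)) with (- (Phi (clamp01 t) - FN N t)) by ring.
    rewrite Cmod_opp; lra. }
  split.
  - exact (Rle_lt_trans _ _ _ (Rabs_Re_le (FN N t - Phi (clamp01 t))) B').
  - exact (Rle_lt_trans _ _ _ (Rabs_Im_le (FN N t - Phi (clamp01 t))) B'). }
destruct (filterlim_RInt (V := C_R_CompleteNormedModule) FN 0 1 eventually _ _ (Csum h) HI HU) as [I [H1 H2]].
replace (Lop x nu f z) with (I : C); [exact H1|].
symmetry; apply (is_RInt_unique (V := C_R_CompleteNormedModule)).
(* Only the open interval is compared, and there [clamp01] is the identity. *)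
eapply is_RInt_ext; [|exact H2].
intros t; rewrite Rmin_left, Rmax_right by lra; intros Ht; cbv beta.
rewrite clamp01_id by lra; reflexivity.
Qed.

Theorem proposition4p1 (x nu : C)
  (hxneg : ~ (Im x = 0%R /\ (Re x <= 0)%R)) (hx1 : x <> RtoC 1)
  (hnu : (Re nu < 0)%R)
  (Estar K : C -> C) (hE : H0 Estar) (hK : H0 K)
  (Ecoef Kcoef : nat -> C)
  (hEseries : forall z : C,
     is_series (V := C_NormedModule)
       (fun n => (Ecoef (S n) * (z ^ S n / INR (fact (S n))))%C) (Estar z))
  (hKseries : forall z : C,
     is_series (V := C_NormedModule)
       (fun n => ((- (1)) ^ S n * Kcoef (S n) * (z ^ S n / INR (fact (S n))))%C)
       (K z)) :
  (forall z : C, Lop x nu Estar z = K z) <->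
  (forall b : nat, (1 <= b)%nat ->
     sum_n_m (G := C_AbelianMonoid)
       (fun l => ((- (1)) ^ l * Binomial.C b l * Qcoef x nu b l * Ecoef l)%C) 1 b
     = Kcoef b).
Proof.
assert (F := INR_fact_neq_0_C).
(* The given expansions start at 1; a zero coefficient is put in front to obtain ordinary power
   series. *)
set (e := fun n => match n with O => RtoC 0 | S _ => Ecoef n / INR (fact n) end).
set (k := fun n => match n with O => RtoC 0 | S _ => (- (1)) ^ n * Kcoef n / INR (fact n) end).
set (S_ := fun b => sum_n_m (G := C_AbelianMonoid)
       (fun l => ((- (1)) ^ l * Binomial.C b l * Qcoef x nu b l * Ecoef l)%C) 1 b : C).
(* These will be the Taylor coefficients of [Lop x nu Estar]: (-1)^(n-l) = (-1)^n (-1)^l, and n! /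
   (l! (n-l)!) is the binomial coefficient. *)
set (s := fun n => match n with O => RtoC 0 | S _ => (- (1)) ^ n * S_ n / INR (fact n) end).
assert (He : forall z, is_Cseries (fun n => e n * z ^ n) (Estar z)).
{ intros z; apply is_Cseries_shift; [simpl; ring|].
  eapply is_Cseries_ext; [|exact (hEseries z)].
  intros n; unfold e, Cdiv; cbv beta iota; ring. }
assert (Hk : forall z, is_Cseries (fun n => k n * z ^ n) (K z)).
{ intros z; apply is_Cseries_shift; [simpl; ring|].
  eapply is_Cseries_ext; [|exact (hKseries z)].
  intros n; unfold k, Cdiv; cbv beta iota; ring. }
assert (HL : forall z, is_Cseries (fun n => s n * z ^ n) (Lop x nu Estar z)).
{ intros z; eapply is_Cseries_ext;
    [|exact (@Lop_series x nu Estar e z hxneg hx1 hnu eq_refl He)].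
  intros [|n]; cbv beta.
  - rewrite sum_O; simpl; ring.
  - rewrite (Cmult_comm (s (S n))); f_equal.
    unfold s, S_, sum_n; rewrite sum_Sn_m by lia.
    match goal with |- plus ?u ?v = _ => transitivity v end.
    { unfold e at 1; rewrite !Cmult_0_l; apply (plus_zero_l (G := C_AbelianMonoid)). }
    unfold Cdiv; rewrite Cmult_comm, Cmult_assoc.
    set (c := / INR (fact (S n)) * (- (1)) ^ S n).
    rewrite <- (sum_n_m_mult_l (K := C_Ring) c); apply sum_n_m_ext_loc.
    intros [|l] Hl; [lia|].
    match goal with |- ?a = mult ?u ?v => change (a = Cmult u v) end.
    unfold e, c; cbv beta iota.
    replace (Binomial.C (S n) (S l)) with
      (INR (fact (S n)) / (INR (fact (S l)) * INR (fact (S n - S l))))%R by reflexivity.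
    rewrite RtoC_div, RtoC_mult by (apply Rmult_integral_contrapositive; split; apply INR_fact_neq_0).
    assert (M : (- (1)) ^ (S n - S l) = (- (1)) ^ S n * (- (1)) ^ S l).
    { replace ((- (1)) ^ S n) with ((- (1)) ^ (S n - S l) * (- (1)) ^ S l)
        by (rewrite <- Cpow_add_r; f_equal; lia).
      rewrite <- Cmult_assoc, <- Cpow_mult_l.
      replace (- (1) * - (1)) with (RtoC 1) by ring; rewrite Cpow_1_l; ring. }
    rewrite M; match goal with |- @eq _ ?a ?b => refine (_ : @eq C a b) end.
    field; repeat split; apply F. }
(* The coefficient equation differs from the linear one by the nonzero factor (-1)^b / b!. *)
assert (Hs : forall b, (1 <= b)%nat -> (s b = k b <-> S_ b = Kcoef b)).
{ intros [|b] Hb; [lia|]; unfold s, k; split; intros H.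
  - assert (P : (- (1)) ^ S b <> 0)
      by (apply Cpow_nz; intros h; apply (f_equal Re) in h; simpl in h; lra).
    replace (S_ (S b)) with ((- (1)) ^ S b * S_ (S b) / INR (fact (S b)) * (INR (fact (S b)) / (- (1)) ^ S b))
      by (field; split; [exact P|apply F]).
    rewrite H; field; split; [exact P|apply F].
  - now rewrite H. }
(* Forward, [K] has two expansions, whose coefficients agree; backward, both functions are sums of
   the same series. *)
split.
- intros H b Hb; apply (Hs b Hb).
  apply (@Cpower_series_inj s k K); [|exact Hk].
  intros z; rewrite <- H; apply HL.
- intros H z; apply (is_Cseries_unique (a := fun n => s n * z ^ n)); [apply HL|].
  eapply is_Cseries_ext; [|exact (Hk z)].
  intros [|n]; [reflexivity|]; cbv beta; f_equal; symmetry; apply Hs; [lia|].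
  apply H; lia.
Qed.
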